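(* Fix $n\ge1$ and $D>0$. The following statements are equivalent: (A) For all isotropic log-concave probability measures $\mu$ on $\mathbb{R}^n$, $\frac1n\operatorname{Var}_{X\sim\mu}(|X|^2)\le2D$. (B) For all isotropic log-concave probability measures $\mu$ on $\mathbb{R}^n$, $\frac1n\log\det A_t\ge-Dt$ for all $t>0$. (C) For all isotropic log-concave probability measures $\mu$ on $\mathbb{R}^n$, $\frac1n\operatorname{tr}(B_t)\ge e^{-Dt}$ for all $t>0$. Here $A_t$ and $B_t$ are the covariance and second-moment matrices of the Gaussian tilt $\mu_t$ of $\mu$.
   Context: $|\cdot|$ is the Euclidean norm. A log-concave probability measure on $\mathbb{R}^n$ is a probability measure having a density $f$ with $\log f$ concave. $\operatorname{Cov}(\mu)=\mathbb{E}(X-\mathbb{E}X)\otimes(X-\mathbb{E}X)$ for $X\sim\mu$; $\mu$ is isotropic if $\mathbb{E}X=0$ and $\operatorname{Cov}(\mu)=\operatorname{Id}$. For $t\ge0$ the Gaussian-tilted measure is $d\mu_t(x)=\frac1{Z(t)}e^{-\frac12t|x|^2}\,d\mu(x)$ with $Z(t)=\int_{\mathbb{R}^n}e^{-\frac12t|x|^2}\,d\mu(x)$. With $X_t\sim\mu_t$, $B_t:=\mathbb{E}X_t\otimes X_t$ and $A_t:=\operatorname{Cov}(\mu_t)$. *)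

(* Defs.v *)
From HB Require Import structures.
From mathcomp Require Import all_boot all_order all_algebra.
From mathcomp Require Import all_classical all_reals all_analysis.
From mathcomp Require Import measurable_realfun.

Set Implicit Arguments.
Unset Strict Implicit.
Unset Printing Implicit Defensive.

Import Order.TTheory GRing.Theory Num.Theory.
Import numFieldNormedType.Exports.

Local Open Scope classical_set_scope.
Local Open Scope ring_scope.

(* R^n is 'rV[R]_n, with the product sigma-algebra (the Borel sets). *)

Section measurable_rV.
Context {R : realType} (n : nat).

Let coor (i : 'I_n) (x : 'rV[R]_n) : measurableTypeR R := x 0 i.

Let rV_set0 : g_sigma_preimage coor set0.
Proof. exact: sigma_algebra0. Qed.

Let rV_setC A : g_sigma_preimage coor A -> g_sigma_preimage coor (~` A).
Proof. exact: sigma_algebraC. Qed.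

Let rV_bigcup (F : _^nat) : (forall i, g_sigma_preimage coor (F i)) ->
  g_sigma_preimage coor (\bigcup_i (F i)).
Proof. exact: sigma_algebra_bigcup. Qed.

HB.instance Definition _ := @isMeasurable.Build default_measure_display
  'rV[R]_n (g_sigma_preimage coor) rV_set0 rV_setC rV_bigcup.

Lemma measurable_coord (i : 'I_n) :
  measurable_fun [set: 'rV[R]_n] (fun x : 'rV[R]_n => x 0 i : R).
Proof.
move=> _ Y mY; rewrite setTI; apply: sub_sigma_algebra => /=.
rewrite -bigcup_seq/=; exists i => /=; first by rewrite mem_index_enum.
by exists Y => //; rewrite setTI.
Qed.

Lemma measurable_fun_rVP d (T : measurableType d) (f : T -> 'rV[R]_n) :
  measurable_fun [set: T] f <->
  forall i, measurable_fun [set: T] (fun x => f x 0 i : R).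
Proof.
split=> [mf i|mf].
  exact: (measurableT_comp (measurable_coord i) mf).
have H : g_sigma_preimage coor `<=` [set A | measurable (f @^-1` A)].
  apply: smallest_sub.
    split => /=.
    - by rewrite preimage_set0.
    - by move=> A /= mA; rewrite setTD preimage_setC; exact: measurableC.
    - move=> F mF /=; rewrite preimage_bigcup.
      by apply: bigcupT_measurable => i; exact: mF.
  rewrite -bigcup_seq/=; apply: bigcup_sub => i _ A [B mB <-]/=.
  rewrite setTI; have := mf i measurableT B mB.
  by rewrite setTI.
by move=> _ A mA; rewrite setTI; exact: H.
Qed.

End measurable_rV.

Section sigma_finite_copy.
Context d (T : measurableType d) (R : realType).
Variables (m : {measure set T -> \bar R}) (m_sf : sigma_finite setT m).

Definition sigma_finite_copy of sigma_finite setT m : set T -> \bar R := m.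

HB.instance Definition _ := Measure.on (sigma_finite_copy m_sf).
HB.instance Definition _ :=
  Measure_isSigmaFinite.Build _ _ _ (sigma_finite_copy m_sf) m_sf.

End sigma_finite_copy.

Section lebesgue_rV.
Context {R : realType}.

Definition rV_cons n (p : measurableTypeR R * 'rV[R]_n) : 'rV[R]_n.+1 :=
  row_mx (const_mx p.1 : 'rV[R]_1) p.2.

Fixpoint lebesgue_rV n : set 'rV[R]_n -> \bar R :=
  if n is m.+1 then pushforward (lebesgue_measure \x @lebesgue_rV m)%E
                                (@rV_cons m)
  else \d_(0 : 'rV[R]_0).

Definition rV_uncons n (x : 'rV[R]_n.+1) : measurableTypeR R * 'rV[R]_n :=
  (x 0 ord0, \row_i x 0 (lift ord0 i)).

Lemma rV_cons0 n p : @rV_cons n p 0 ord0 = p.1.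
Proof.
by rewrite /rV_cons mxE; case: splitP => [j _|j //]; rewrite mxE.
Qed.

Lemma rV_consS n p i : @rV_cons n p 0 (lift ord0 i) = p.2 0 i.
Proof.
rewrite /rV_cons mxE; case: splitP => [j|j] /=; first by rewrite ord1.
by rewrite /bump/= !add1n => -[ij]; congr (p.2 0 _); exact: val_inj.
Qed.

Lemma rV_consK n : cancel (@rV_cons n) (@rV_uncons n).
Proof.
move=> [a x]; rewrite /rV_uncons rV_cons0; congr pair.
by apply/rowP => i; rewrite mxE rV_consS.
Qed.

Lemma rV_unconsK n : cancel (@rV_uncons n) (@rV_cons n).
Proof.
move=> x; apply/rowP => i; case: (unliftP ord0 i) => [j ->|->].
  by rewrite rV_consS mxE.
by rewrite rV_cons0.
Qed.

Lemma measurable_rV_cons n : measurable_fun setT (@rV_cons n).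
Proof.
apply/measurable_fun_rVP => i; case: (unliftP ord0 i) => [j ->|->].
  under eq_fun do rewrite rV_consS.
  exact: (measurableT_comp (measurable_coord j) measurable_snd).
under eq_fun do rewrite rV_cons0; exact: measurable_fst.
Qed.

Lemma measurable_rV_uncons n : measurable_fun setT (@rV_uncons n).
Proof.
apply: measurable_fun_pair; first exact: measurable_coord.
apply/measurable_fun_rVP => i; under eq_fun do rewrite mxE.
exact: measurable_coord.
Qed.

Lemma lebesgue_rV_sigma_finite_measure n :
  exists m : {sigma_finite_measure set 'rV[R]_n -> \bar R}, @lebesgue_rV n = m.
Proof.
elim: n => [|n [m mE]].
  by exists (\d_(0 : 'rV[R]_0) : {sigma_finite_measure set _ -> \bar R}).
pose mm : {measure set (measurableTypeR R * 'rV[R]_n) -> \bar R} :=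
  (lebesgue_measure \x m)%E.
have [nu nuE] : exists nu : {measure set 'rV[R]_n.+1 -> \bar R},
    pushforward mm (@rV_cons n) = nu.
  unshelve eexists (pushforward mm (@rV_cons n)) => //.
  exact: measurable_rV_cons.
have nu_sf : sigma_finite setT nu.
  have [F FT mF] : sigma_finite setT (lebesgue_measure \x m)%E.
    have /sigma_finiteP[F [FT ndF Foo]] := sigma_finiteT
      (lebesgue_measure : {sigma_finite_measure set (measurableTypeR R) -> \bar R}).
    have /sigma_finiteP[G [GT ndG Goo]] := sigma_finiteT m.
    exists (fun k => F k `*` G k).
      rewrite -setXTT FT GT; apply/seteqP; split=> [[a x] [/= [i _ Fi] [j _ Gj]]|
        [a x] [i _ [/= Fi Gi]]]; last by split; exists i.
      exists (maxn i j) => //; split => /=.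
        by move: a Fi; exact/subsetPset/ndF/leq_maxl.
      by move: x Gj; exact/subsetPset/ndG/leq_maxr.
    move=> k; have [? ?] := Foo k; have [? ?] := Goo k.
    split; first exact: measurableX.
    by rewrite product_measure1E// lte_mul_pinfty// ge0_fin_numE.
  exists (fun i => @rV_uncons n @^-1` F i).
    by rewrite -preimage_bigcup -FT preimage_setT.
  move=> i; have [mFi Fioo] := mF i; split.
    by rewrite -[X in measurable X]setTI; exact: measurable_rV_uncons.
  rewrite -nuE /pushforward -comp_preimage (_ : _ \o _ = id)//.
  by apply/funext => p /=; rewrite rV_consK.
by exists (sigma_finite_copy nu_sf); rewrite /= mE.
Qed.

Section instances.
Variable n : nat.
Local Notation lam := (@lebesgue_rV n).

Let lam0 : lam set0 = 0%E.
Proof. by have [m ->] := lebesgue_rV_sigma_finite_measure n. Qed.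

Let lam_ge0 A : (0 <= lam A)%E.
Proof. by have [m ->] := lebesgue_rV_sigma_finite_measure n. Qed.

Let lam_semi_sigma_additive : semi_sigma_additive lam.
Proof.
have [m ->] := lebesgue_rV_sigma_finite_measure n.
exact: measure_semi_sigma_additive.
Qed.

HB.instance Definition _ := isMeasure.Build _ _ _ lam
  lam0 lam_ge0 lam_semi_sigma_additive.

Let lam_sigma_finite : sigma_finite setT lam.
Proof.
have [m ->] := lebesgue_rV_sigma_finite_measure n; exact: sigma_finiteT.
Qed.

HB.instance Definition _ := Measure_isSigmaFinite.Build _ _ _ lam
  lam_sigma_finite.

End instances.

Lemma lebesgue_rV_box n (A : 'I_n -> set R) :
  (forall i, measurable (A i)) ->
  lebesgue_rV [set x : 'rV[R]_n | forall i, A i (x 0 i)] =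
  (\prod_(i < n) lebesgue_measure (A i))%E.
Proof.
elim: n A => [|n IHn] A mA /=.
  by rewrite big_ord0 diracE mem_set//= => -[].
rewrite /pushforward big_ord_recl -IHn//.
have mB : measurable [set x : 'rV[R]_n | forall i, A (lift ord0 i) (x 0 i)].
  rewrite (_ : mkset _ =
    \bigcap_(i in [set: 'I_n]) ((fun x : 'rV[R]_n => x 0 i) @^-1` A (lift ord0 i))).
    apply: fin_bigcap_measurable => // i _.
    by rewrite -[X in measurable X]setTI; exact: measurable_coord.
  by apply/seteqP; split=> x /= H => [i _|i]; exact: H.
rewrite -[RHS](@product_measure1E _ _ _ _ _ lebesgue_measure (@lebesgue_rV n))//;
  last exact: mA.
congr ((_ \x _)%E _).
apply/seteqP; split=> [[a x] /= H|[a x] /= [H0 H] i].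
  split; first by have := H ord0; rewrite rV_cons0.
  by move=> i; have := H (lift ord0 i); rewrite rV_consS.
by case: (unliftP ord0 i) => [j ->|->]; rewrite ?rV_consS ?rV_cons0.
Qed.

End lebesgue_rV.

Section definitions.
Context {R : realType} {n : nat}.
Implicit Types (x y : 'rV[R]_n) (mu : probability 'rV[R]_n R).

(* [`|x|] on ['rV[R]_n] is the sup norm, hence this definition. *)
Definition eucl_norm x : R := Num.sqrt (\sum_(i < n) x 0 i ^+ 2).

(* [log f] takes its values in [[-oo, +oo)], with [log 0 = -oo]. *)
Definition log_concave (f : 'rV[R]_n -> R) : Prop :=
  forall x y (s : R), 0 <= s <= 1 ->
    (s%:E * lne (f x)%:E + (1 - s)%:E * lne (f y)%:E <=
     lne (f (s *: x + (1 - s) *: y)%R)%:E)%E.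

Definition has_density mu (f : 'rV[R]_n -> R) : Prop :=
  [/\ measurable_fun [set: 'rV[R]_n] f, forall x, 0 <= f x &
      forall A, measurable A ->
        mu A = (\int[@lebesgue_rV R n]_(x in A) (f x)%:E)%E].

Definition log_concave_measure mu : Prop :=
  exists2 f, has_density mu f & log_concave f.

(* In the next three definitions [fine] truncates infinite values to 0. This
   is harmless: log-concave measures have moments of all orders, and no
   measure with an infinite second moment satisfies [isotropic]. *)
Definition mean mu : 'rV[R]_n := \row_i fine 'E_mu[fun x => x 0 i].

Definition cov_mx mu : 'M[R]_n :=
  \matrix_(i, j) fine (covariance mu (fun x => x 0 i) (fun x => x 0 j)).

Definition second_moment_mx mu : 'M[R]_n :=
  \matrix_(i, j) fine 'E_mu[fun x => x 0 i * x 0 j].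

Definition isotropic mu : Prop := mean mu = 0 /\ cov_mx mu = 1%:M.

Definition gauss_weight (t : R) x : R := expR (- (t / 2) * eucl_norm x ^+ 2).

Definition gauss_weighted mu (t : R) : set 'rV[R]_n -> \bar R :=
  fun A => (\int[mu]_(x in A) (gauss_weight t x)%:E)%E.

Lemma measurable_eucl_norm : measurable_fun [set: 'rV[R]_n] eucl_norm.
Proof.
apply: (measurableT_comp (f := @Num.sqrt R)) => //.
  apply: continuous_measurable_fun; exact: sqrt_continuous.
apply: measurable_sum => i; apply: measurable_funX; exact: measurable_coord.
Qed.

Lemma measurable_gauss_weight t :
  measurable_fun [set: 'rV[R]_n] (gauss_weight t).
Proof.
apply: (measurableT_comp (f := @expR R)) => //.
apply: measurable_funM => //; apply: measurable_funX.
exact: measurable_eucl_norm.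
Qed.

Section gauss_weighted_measure.
Variables (mu : probability 'rV[R]_n R) (t : R).

Let gauss_weighted0 : gauss_weighted mu t set0 = 0%E.
Proof. by rewrite /gauss_weighted integral_set0. Qed.

Let gauss_weighted_ge0 A : (0 <= gauss_weighted mu t A)%E.
Proof. by apply: integral_ge0 => x _; rewrite lee_fin expR_ge0. Qed.

Let gauss_weighted_sigma_additive : semi_sigma_additive (gauss_weighted mu t).
Proof.
move=> F mF tF mUF; rewrite /gauss_weighted ge0_integral_bigcup//=.
- apply: is_cvg_ereal_nneg_natsum_cond => i _ _.
  exact: gauss_weighted_ge0.
- apply/measurable_EFinP; apply: measurable_funTS.
  exact: measurable_gauss_weight.
- by move=> x _; rewrite lee_fin expR_ge0.
Qed.

HB.instance Definition _ := isMeasure.Build _ _ _ (gauss_weighted mu t)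
  gauss_weighted0 gauss_weighted_ge0 gauss_weighted_sigma_additive.

End gauss_weighted_measure.

Definition tiltZ mu (t : R) : \bar R := (\int[mu]_x (gauss_weight t x)%:E)%E.

(* [mu_t]; the default value of [mnormalize] is never used for [0 <= t], see
   [gauss_tiltE]. *)
Definition gauss_tilt mu (t : R) : probability 'rV[R]_n R :=
  mnormalize (gauss_weighted mu t) mu.

Lemma tiltZ_bounds mu t : 0 <= t -> (0 < tiltZ mu t <= 1)%E.
Proof.
move=> t0; have mw : measurable_fun [set: 'rV[R]_n]
    (fun x => (gauss_weight t x)%:E).
  by apply/measurable_EFinP; exact: measurable_gauss_weight.
have w0 x : (0 <= (gauss_weight t x)%:E)%E by rewrite lee_fin expR_ge0.
apply/andP; split.
  rewrite lt_neqAle integral_ge0// andbT; apply/eqP => Z0.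
  have : (\int[mu]_x `|(gauss_weight t x)%:E|)%E = 0%E.
    by rewrite [RHS]Z0; apply: eq_integral => x _; rewrite gee0_abs.
  move/(ae_eq_integral_abs mu measurableT mw) => [N [mN N0 NT]].
  suff NTT : N = setT.
    have /eqP := probability_setT mu; rewrite -{1}NTT.
    by rewrite (_ : mu N = 0%E)// eq_sym onee_eq0.
  apply/seteqP; split=> // x _; apply: NT => /= /(_ Logic.I) [] /eqP.
  by rewrite gt_eqF// expR_gt0.
rewrite -(@probability_setT _ _ _ mu) -[leRHS]mul1e -integral_cst//.
apply: ge0_le_integral => //= x _.
rewrite lee_fin -expR0 ler_expR mulNr oppr_le0 mulr_ge0 ?sqr_ge0//.
by rewrite divr_ge0.
Qed.

Lemma gauss_tiltE mu t A : 0 <= t ->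
  gauss_tilt mu t A =
  ((fine (tiltZ mu t))^-1%:E * \int[mu]_(x in A) (gauss_weight t x)%:E)%E.
Proof.
move=> /(tiltZ_bounds mu)/andP[Z0 Z1].
rewrite /gauss_tilt/= /mnormalize -/(tiltZ mu t).
rewrite gt_eqF//= lt_eqF ?(le_lt_trans Z1) ?ltry//=.
by rewrite muleC.
Qed.

End definitions.

(* Main.v *)
From HB Require Import structures.
Require Import Defs.
From mathcomp Require Import all_boot all_order all_algebra.
From mathcomp Require Import all_classical all_reals all_analysis.
From mathcomp Require Import measurable_realfun.
From mathcomp Require Import ring lra.

Set Implicit Arguments.
Unset Strict Implicit.
Unset Printing Implicit Defensive.

Import Order.TTheory GRing.Theory Num.Theory.
Import numFieldNormedType.Exports.

Local Open Scope classical_set_scope.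
Local Open Scope ring_scope.

(** Write [E_t], [Cov_t] and [Var_t] for expectation, covariance and variance
    under the tilt [mu_t], [q x = |x|^2], [f t = 1/n * ln (det A_t)] and
    [b t = 1/n * E_t q = 1/n * tr B_t]. Since [d/dt E_t g = - Cov_t (g, q) / 2],
    the three statements are linked as follows.

    (A) implies (B). The function [h t = - 2 f t + b t - D t] is nonincreasing,
    so that [h t <= h 0] (lemma [le_lyapunov0]). Formally, if [Y] is [mu_s]
    normalised to be isotropic and [U = |Y|^2], then
    [- 2 f' = 1/n * Cov_s (U, q)] and [b' = - 1/(2n) * Var_s q], so that
    [n h' = Cov_s (U, q) - Var_s q / 2 - n D <= Var_s U / 2 - n D], and this is
    nonpositive by (A) applied to the law of [Y], which is again isotropic and
    log-concave. As [h 0 = 1] and [b >= exp f >= 1 + f] by the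
    arithmetic-geometric inequality, [h t <= 1] gives [- f t <= D t].

    The determinant is never differentiated. Concavity of [ln det] gives, for
    all [r, s > 0], the bound [n (f r - f s) <= E_r U - n] (lemma
    [ln_det_tilt_cov_mx_le]), with equality at [r = s]; so near [s] the function
    [h] lies above an explicit function of [r] that agrees with it at [s] and
    has nonpositive derivative there, and a continuous function touched from
    below in this way at every point is nonincreasing (lemma
    [nonincreasing_touch]).

    The matrix normalising [mu_s] is taken lower triangular: if
    [A_s = L *m L^T] is the Cholesky decomposition, [Y = L^-1 (X - E_s X)]. Only
    the change of variables for triangular affine maps is then needed, and it
    follows from Tonelli's theorem and the one-dimensional case by induction on
    the dimension (lemma [integral_trig_affine]).

    (B) implies (C). [1/n * tr B_t >= 1/n * tr A_t >= (det A_t)^(1/n)].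

    (C) implies (A). From [b t >= exp (- D t) >= 1 - D t] one gets
    [\int (n - q) w_t dmu <= n D t], where [w_t] is the Gaussian weight. As
    [\int (n - q) dmu = 0], the constant [exp (- t n / 2)] can be subtracted from
    [w_t], and the integrand becomes at least
    [t / 2 * (n - q)^2 * w_t * exp (- t n / 2)]. Monotone convergence as [t] tends
    to 0 bounds the variance of [q] (lemma [variance_le_of_energy]); no moment of
    order 4 needs to be known to be finite beforehand. *)

(** * Positive definite matrices and the Cholesky decomposition *)

(** A symmetric positive definite matrix. *)
Definition posdefmx (R : realType) n (A : 'M[R]_n) : Prop :=
  A^T = A /\ forall u : 'rV[R]_n, u != 0 -> 0 < (u *m A *m u^T) 0 0.

(** Induction on the dimension: the Schur complement of the top left entry is
    again positive definite. *)
Lemma cholesky (R : realType) n (A : 'M[R]_n) : posdefmx A ->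
  exists L : 'M[R]_n,
    [/\ is_trig_mx L, forall i, 0 < L i i & A = L *m L^T].
Proof.
elim: n A => [|n IHn] A [symA posA].
  exists 0; split; [exact: mx0_is_trig|by case|by apply/matrixP => -[]].
rewrite -[n.+1]/(1 + n)%N in A symA posA *.
set a := A 0 0; set r := dlsubmx A.
have aE : ulsubmx A = a%:M.
  by apply/matrixP => i j; rewrite !ord1 !mxE/= mulr1n /a; congr (A _ _); apply: val_inj.
have rE : ursubmx A = r^T by rewrite /r trmx_dlsub symA.
have AE : A = block_mx a%:M r^T r (drsubmx A) by rewrite -aE -rE submxK.
have a_gt0 : 0 < a.
  have e_neq0 : (row_mx 1%:M 0 : 'rV[R]_(1 + n)) != 0.
    apply/eqP => /rowP/(_ (lshift n 0)); rewrite row_mxEl !mxE/= => /eqP.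
    by rewrite oner_eq0.
  have := posA _ e_neq0.
  rewrite AE mul_row_block tr_row_mx mul_row_col !mul1mx !mul0mx !addr0.
  by rewrite trmx1 trmx0 mulmx0 mulmx1 addr0 mxE eqxx mulr1n.
set s := Num.sqrt a.
have s_gt0 : 0 < s by rewrite sqrtr_gt0.
have ssa : s * s = a by rewrite -expr2 sqr_sqrtr// ltW.
have symD : (drsubmx A)^T = drsubmx A by rewrite trmx_drsub symA.
have [|L [trigL posL LE]] := IHn (drsubmx A - a^-1 *: (r *m r^T)).
  split=> [|u u_neq0].
    by rewrite linearB/= linearZ/= trmx_mul trmxK symD.
  pose v : 'rV[R]_(1 + n) := row_mx (- a^-1 *: (u *m r)) u.
  have v_neq0 : v != 0.
    apply: contra u_neq0 => /eqP v0; apply/eqP/rowP => i.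
    by have /rowP/(_ (rshift 1 i)) := v0; rewrite row_mxEr !mxE.
  have := posA _ v_neq0.
  suff -> : v *m A *m v^T = u *m (drsubmx A - a^-1 *: (r *m r^T)) *m u^T by [].
  rewrite {1}AE mul_row_block tr_row_mx mul_row_col mul_mx_scalar scalerA mulrN.
  rewrite divff ?gt_eqF// scaleN1r addNr mul0mx add0r mulmxBr -scalemxAl.
  by rewrite scaleNr addrC -scalemxAr mulmxA.
exists (block_mx s%:M 0 (s^-1 *: r) L); split.
- by rewrite is_trig_block_mx// eqxx trigL mx11_is_trig.
- move=> i; case: (split_ordP i) => j ->; first by rewrite block_mxEul ord1 mxE eqxx.
  by rewrite block_mxEdr.
- rewrite AE tr_block_mx mulmx_block !trmx0 !mulmx0 !mul0mx !addr0 -LE.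
  rewrite tr_scalar_mx -scalar_mxM ssa linearZ/= mul_scalar_mx scalerA.
  rewrite mul_mx_scalar scalerA divff ?gt_eqF// !scale1r.
  rewrite -scalemxAr -scalemxAl scalerA -invfM ssa.
  by rewrite addrC subrK.
Qed.

Lemma posdefmx_congr (R : realType) n (A M : 'M[R]_n) : M \in unitmx ->
  posdefmx A -> posdefmx (M^T *m A *m M).
Proof.
move=> uM [symA posA]; split=> [|u u0]; first by rewrite !trmx_mul symA trmxK mulmxA.
rewrite (_ : u *m _ *m u^T = u *m M^T *m A *m (u *m M^T)^T); last first.
  by rewrite trmx_mul trmxK !mulmxA.
apply: posA; apply: contra u0 => /eqP uM0.
have uMT : M^T \in unitmx by rewrite unitmx_tr.
by rewrite -(mulmxK uMT u) uM0 mul0mx.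
Qed.

Lemma trig_gt0_unitmx (R : realType) n (L : 'M[R]_n) :
  is_trig_mx L -> (forall i, 0 < L i i) -> L \in unitmx.
Proof.
move=> trigL posL; rewrite unitmxE det_trig// unitfE gt_eqF//.
exact: prodr_gt0.
Qed.

Lemma posdefmx_det_gt0 (R : realType) n (A : 'M[R]_n) : posdefmx A ->
  0 < \det A.
Proof.
move=> /cholesky[L [trigL posL ->]]; rewrite det_mulmx det_tr -expr2.
by rewrite exprn_even_gt0//= -unitfE -unitmxE trig_gt0_unitmx.
Qed.

Lemma ln_prod (R : realType) (I : Type) (s : seq I) (F : I -> R) :
  (forall i, 0 < F i) -> ln (\prod_(i <- s) F i) = \sum_(i <- s) ln (F i).
Proof.
move=> F0; elim: s => [|i s IHs]; first by rewrite !big_nil ln1.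
by rewrite !big_cons lnM ?posrE ?prodr_gt0// IHs.
Qed.

(** The tangent to the concave function [ln \det] at the identity lies above it. *)
Lemma ln_det_le_mxtrace (R : realType) n (A : 'M[R]_n) : posdefmx A ->
  ln (\det A) <= \tr A - n%:R.
Proof.
move=> /cholesky[L [trigL posL ->]].
rewrite det_mulmx det_tr det_trig// -big_split/= ln_prod; last first.
  by move=> i; rewrite mulr_gt0.
rewrite (_ : n%:R = \sum_(i < n) (1 : R)); last by rewrite sumr_const card_ord.
rewrite /mxtrace -sumrB ler_sum// => i _.
have LL0 : 0 < L i i * L i i by rewrite mulr_gt0.
rewrite -[L i i * L i i](subrK 1) addrC (le_trans (le_ln1Dx _))//.
  by rewrite ltrBrDr addNr.
rewrite lerD2r mxE (bigD1 i)//= mxE ler_wpDr//.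
by apply: sumr_ge0 => j _; rewrite mxE -expr2 sqr_ge0.
Qed.

(** Arithmetic-geometric inequality for the eigenvalues of [A]. *)
Lemma expR_ln_det_le_mxtrace (R : realType) n (A : 'M[R]_n) : (0 < n)%N ->
  posdefmx A -> expR (n%:R^-1 * ln (\det A)) <= n%:R^-1 * \tr A.
Proof.
move=> n0 pA; have [symA posA] := pA; set f := n%:R^-1 * _.
have nR0 : 0 < n%:R :> R by rewrite ltr0n.
have : posdefmx (expR (- f) *: A).
  split=> [|u u0]; first by rewrite linearZ/= symA.
  by rewrite -scalemxAr -scalemxAl mxE mulr_gt0 ?expR_gt0// posA.
move=> /ln_det_le_mxtrace; rewrite detZ mxtraceZ lnM ?posrE; last 2 first.
- by rewrite exprn_gt0 ?expR_gt0.
- exact: posdefmx_det_gt0.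
rewrite lnXn ?expR_gt0// expRK mulNrn -[f *+ n]mulr_natl {1}/f mulrA divff ?gt_eqF//.
rewrite mul1r addNr -/f subr_ge0 mulrC expRN ler_pdivlMr ?expR_gt0// => H.
by rewrite ler_pdivlMl.
Qed.

(** * Integration against densities and image measures *)

(** Change of variables for an integrand of any sign. Integrability is not
    needed, because the integral is defined as the difference of the integrals
    of the positive and negative parts. *)
Lemma integral_pushforward_signed d1 d2 (X : measurableType d1)
    (Y : measurableType d2) (R : realType) (phi : X -> Y)
    (mu : {measure set X -> \bar R}) (f : Y -> \bar R) :
  measurable_fun setT phi -> measurable_fun setT f ->
  (\int[pushforward mu phi]_y f y = \int[mu]_x f (phi x))%E.
Proof.
move=> mphi mf.
have [nu nuE] : exists nu : {measure set Y -> \bar R}, pushforward mu phi = nu.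
  by unshelve eexists (pushforward mu phi).
transitivity (\int[pushforward mu phi]_y f^\+ y -
              \int[pushforward mu phi]_y f^\- y)%E; first by rewrite nuE integralE.
rewrite [RHS]integralE; congr (_ - _)%E.
  rewrite (ge0_integral_pushforward mphi mu measurableT)//=.
    by rewrite preimage_setT; apply: eq_integral => x _; rewrite !funeposE.
  exact: measurable_funepos.
rewrite (ge0_integral_pushforward mphi mu measurableT)//=.
  by rewrite preimage_setT; apply: eq_integral => x _; rewrite !funenegE.
exact: measurable_funeneg.
Qed.

(** If [P] has density [p] with respect to [mu] then [dP = p dmu] inside every
    integral; again no integrability is needed. *)
Lemma integral_density d (T : measurableType d) (R : realType)
    (mu : {sigma_finite_measure set T -> \bar R}) (P : probability T R)
    (p : T -> R) (f : T -> \bar R) :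
  measurable_fun setT p -> (forall x, 0 <= p x) ->
  (forall A, measurable A -> P A = \int[mu]_(x in A) (p x)%:E)%E ->
  measurable_fun setT f ->
  (\int[P]_x f x = \int[mu]_x (f x * (p x)%:E))%E.
Proof.
move=> mp p0 pE.
have dom : P `<< mu.
  apply/null_content_dominatesP => A mA A0; rewrite pE//.
  by apply: null_set_integral => //; exact/measurable_EFinP/measurable_funTS.
have ae : ae_eq mu setT (Radon_Nikodym_SigmaFinite.f P mu) (EFin \o p).
  apply: integral_ae_eq => //.
  - exact: Radon_Nikodym_SigmaFinite.f_integrable.
  - exact/measurable_EFinP.
  - move=> A _ mA; rewrite -Radon_Nikodym_SigmaFinite.f_integral//.
    by rewrite -pE.
have ge0P (g : T -> \bar R) : measurable_fun setT g -> (forall x, 0 <= g x)%E ->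
    (\int[P]_x g x = \int[mu]_x (g x * (p x)%:E))%E.
  move=> mg g0; rewrite -(Radon_Nikodym_SigmaFinite.change_of_variables dom)//.
  apply: ae_eq_integral => //.
  - apply: emeasurable_funM => //.
    exact: measurable_int (Radon_Nikodym_SigmaFinite.f_integrable _).
  - by apply: emeasurable_funM => //; exact/measurable_EFinP.
  - exact: ae_eqe_mul2l.
move=> mf; rewrite integralE [RHS]integralE.
rewrite ge0P//; last exact: measurable_funepos.
rewrite ge0P//; last exact: measurable_funeneg.
by congr (_ - _)%E; apply: eq_integral => x _;
  rewrite ?funeposE ?funenegE maxe_pMl ?lee_fin// mul0e ?mulNe.
Qed.

Lemma integral_affine (R : realType) (a b : R) (f : R -> \bar R) : 0 < a ->
  measurable_fun setT f -> (forall x, 0 <= f x)%E ->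
  (\int[lebesgue_measure]_x f (b + a * x)%R =
   (a^-1)%:E * \int[lebesgue_measure]_x f x)%E.
Proof.
move=> a0 mf f0.
pose phi (x : measurableTypeR R) : measurableTypeR R := b + a * x.
have mphi : measurable_fun setT phi.
  by apply: measurable_funD => //; exact: measurable_funM.
have ainv0 : 0 <= a^-1 by rewrite invr_ge0 ltW.
pose nu : {measure set (measurableTypeR R) -> \bar R} :=
  mscale (NngNum ainv0) (@lebesgue_measure R).
have [mu' mu'E] : exists mu' : {measure set (measurableTypeR R) -> \bar R},
    pushforward lebesgue_measure phi = mu'.
  by unshelve eexists (pushforward lebesgue_measure phi).
have H A : measurable A -> lebesgue_measure A = mscale (NngNum (ltW a0)) mu' A.
  apply: lebesgue_measure_unique => _ [[x y] _ <-]/=.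
  rewrite /mscale/= -mu'E /pushforward.
  rewrite (_ : phi @^-1` _ = `]((x - b) / a), ((y - b) / a)]%classic); last first.
    apply/seteqP; split => z /=; rewrite !in_itv/= /phi.
      by rewrite ltr_pdivrMr// ler_pdivlMr// ltrBlDl lerBrDl mulrC.
    by rewrite ltr_pdivrMr// ler_pdivlMr// ltrBlDl lerBrDl mulrC.
  rewrite !lebesgue_measure_itv/= !lte_fin ltr_pM2r ?invr_gt0// ltrD2r.
  case: ifP => // _; last by rewrite mule0.
  by rewrite -!EFinB -EFinM; congr EFin; field; rewrite gt_eqF.
transitivity (\int[pushforward lebesgue_measure phi]_x f x)%E.
  by rewrite (ge0_integral_pushforward mphi lebesgue_measure measurableT)//= preimage_setT.
rewrite mu'E.
rewrite [in RHS](eq_measure_integral (mscale (NngNum (ltW a0)) mu')); last first.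
  by move=> A mA _; exact: H.
rewrite ge0_integral_mscale//= muleA -EFinM mulVf ?gt_eqF// mul1e//.
Qed.

(** * Triangular affine changes of variables *)

Lemma measurable_affine (R : realType) (n k : nat) (M : 'M[R]_(n, k)) (b : 'rV[R]_k) :
  measurable_fun setT (fun x : 'rV[R]_n => x *m M + b).
Proof.
apply/measurable_fun_rVP => i.
have -> : (fun x : 'rV[R]_n => (x *m M + b) 0 i : R) =
    (fun x => \sum_j x 0 j * M j i + b 0 i).
  by apply/funext => x; rewrite !mxE.
apply: measurable_funD => //; apply: measurable_sum => j.
by apply: measurable_funM => //; exact: measurable_coord.
Qed.

(** Tonelli's theorem, in the form of the recursive definition of the Lebesgue
    measure on [R^n]. *)
Lemma integral_lebesgue_rV_recl (R : realType) (n : nat)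
    (k : 'rV[R]_n.+1 -> \bar R) :
  measurable_fun setT k -> (forall x, 0 <= k x)%E ->
  (\int[@lebesgue_rV R n.+1]_x k x =
   \int[lebesgue_measure]_a \int[@lebesgue_rV R n]_y k (rV_cons (a, y)))%E.
Proof.
move=> mk k0.
transitivity (\int[(lebesgue_measure \x @lebesgue_rV R n)%E]_p k (rV_cons p))%E.
  by rewrite [LHS](ge0_integral_pushforward (@measurable_rV_cons R n)
    (lebesgue_measure \x @lebesgue_rV R n)%E measurableT).
rewrite fubini_tonelli1//.
by apply: measurableT_comp mk _; exact: measurable_rV_cons.
Qed.

(** Change of variables [x = L y + b] for a lower triangular [L]. The first
    coordinate of [x] depends only on that of [y], and for a fixed first
    coordinate the others are related by a triangular affine map of dimension
    one less, whose translation part varies. *)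
Lemma integral_trig_affine (R : realType) (n : nat) (L : 'M[R]_n) :
  is_trig_mx L -> (forall i, 0 < L i i) ->
  forall (b : 'rV[R]_n) (k : 'rV[R]_n -> \bar R),
    measurable_fun setT k -> (forall x, 0 <= k x)%E ->
  (\int[@lebesgue_rV R n]_y k (y *m L^T + b)%R =
   ((\det L)^-1)%:E * \int[@lebesgue_rV R n]_x k x)%E.
Proof.
elim: n L => [|n IHn] L trigL posL b k mk k0.
  rewrite det_mx00 invr1 mul1e; apply: eq_integral => y _.
  by congr k; apply/rowP => -[].
rewrite -[n.+1]/(1 + n)%N in L trigL posL b *.
have LE : L = block_mx (L 0 0)%:M 0 (dlsubmx L) (drsubmx L).
  rewrite -[LHS]submxK; congr block_mx.
    by apply/matrixP => i j; rewrite !ord1 !mxE/= mulr1n; congr (L _ _); apply: val_inj.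
  apply/matrixP => i j; rewrite !mxE; apply/eqP.
  move/is_trig_mxP : trigL => ->//.
  by rewrite ord1.
have trigL' : is_trig_mx (drsubmx L).
  by have := trigL; rewrite {1}LE is_trig_block_mx// => /and3P[].
have posL' i : 0 < (drsubmx L) i i by rewrite !mxE; exact: posL.
set a := L 0 0 in LE *; set r := dlsubmx L in LE; set L' := drsubmx L in LE trigL' posL'.
have a0 : 0 < a by exact: posL.
have consE (c : R) (y : 'rV[R]_n) : rV_cons (c, y) *m L^T + b =
    rV_cons (b 0 0 + a * c, y *m L'^T + (c *: r^T + rsubmx b)).
  transitivity (row_mx (const_mx c : 'rV[R]_1) y *m (block_mx a%:M 0 r L')^T + b).
    by rewrite -LE.
  rewrite tr_block_mx trmx0 mul_row_block mulmx0 addr0.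
  rewrite tr_scalar_mx -[b in LHS]hsubmxK add_row_mx; congr row_mx => /=.
    apply/rowP => i; rewrite ord1 !mxE/= addrC mulrC; congr (b _ _ + _).
      exact: val_inj.
    by rewrite big_ord1 !mxE mulr1n mulrC.
  rewrite addrA [_ + c *: _]addrC; congr (_ + _ + _).
  by apply/rowP => i; rewrite !mxE big_ord1 !mxE.
have mkc : measurable_fun setT (fun p : measurableTypeR R * 'rV[R]_n => k (rV_cons p)).
  by apply: measurableT_comp mk _; exact: measurable_rV_cons.
rewrite integral_lebesgue_rV_recl//; last first.
  by apply: measurableT_comp mk _; exact: measurable_affine.
under eq_integral => c _.
  under eq_integral => y _ do rewrite consE.
  rewrite (IHn L' trigL' posL' _ (fun y => k (rV_cons (b 0 0 + a * c, y))))//; last first.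
    exact: (measurableT_comp mkc (pair1_measurable (b 0 0 + a * c : measurableTypeR R))).
  over.
rewrite /=.
pose F c := (\int[@lebesgue_rV R n]_y k (rV_cons (c, y)))%E.
have mF : measurable_fun setT F.
  exact: (measurable_fun_fubini_tonelli_F
    (fun p : measurableTypeR R * 'rV[R]_n => k (rV_cons p))).
have F0 c : (0 <= F c)%E by exact: integral_ge0.
rewrite (@ge0_integralZl_EFin _ _ _ lebesgue_measure _ measurableT
  (fun c => F (b 0 0 + a * c)))//.
- rewrite (integral_affine (b 0 0) a0 mF F0) muleA -EFinM.
  rewrite -integral_lebesgue_rV_recl//; congr (_%:E * _)%E.
  by rewrite LE det_lblock det_scalar1 invfM mulrC.
- apply: (measurableT_comp mF); apply: measurable_funD => //; exact: measurable_funM.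
- by rewrite invr_ge0 det_trig// prodr_ge0// => i _; rewrite ltW.
Qed.

(** * Log-concavity and densities of tilts and affine images *)

Lemma eucl_norm_sqr (R : realType) n (x : 'rV[R]_n) :
  eucl_norm x ^+ 2 = \sum_i x 0 i ^+ 2.
Proof. by rewrite sqr_sqrtr// sumr_ge0// => i _; rewrite sqr_ge0. Qed.

(** Log-concavity on the set where [f] is positive, without extended reals. *)
Lemma log_concaveP (R : realType) n (f : 'rV[R]_n -> R) :
  (forall x, 0 <= f x) ->
  log_concave f <-> forall x y s, 0 < s < 1 -> 0 < f x -> 0 < f y ->
    0 < f (s *: x + (1 - s) *: y) /\
    s * ln (f x) + (1 - s) * ln (f y) <= ln (f (s *: x + (1 - s) *: y)).
Proof.
move=> f0; split=> [lc x y s /andP[s0 s1] fx0 fy0|lc x y s /andP[]].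
  have := lc x y s; rewrite (ltW s0) (ltW s1) (lne_EFin fx0) (lne_EFin fy0) => /(_ isT).
  have := f0 (s *: x + (1 - s) *: y); rewrite le_eqVlt => /predU1P[<-|fz0].
    by rewrite /= lexx.
  by rewrite lne_EFin// -!EFinM -EFinD lee_fin; split.
rewrite le_eqVlt => /predU1P[<- _|s0].
  by rewrite subr0 !scale0r add0r scale1r mul0e add0e mul1e.
rewrite le_eqVlt => /predU1P[->|s1].
  by rewrite subrr !scale0r addr0 scale1r mul0e adde0 mul1e.
have s10 : 0 < 1 - s by rewrite subr_gt0.
have := f0 x; rewrite le_eqVlt => /predU1P[<-|fx0].
  by rewrite {1}/lne lexx gt0_muleNy ?lte_fin// addNye leNye.
have := f0 y; rewrite le_eqVlt => /predU1P[<-|fy0].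
  by rewrite {2}/lne lexx gt0_muleNy ?lte_fin// addeNy leNye.
have [|fz0 H] := lc x y s _ fx0 fy0; first by rewrite s0.
by rewrite !lne_EFin// -!EFinM -EFinD lee_fin.
Qed.

Lemma log_concaveM (R : realType) n (f g : 'rV[R]_n -> R) :
  (forall x, 0 <= f x) -> (forall x, 0 <= g x) ->
  log_concave f -> log_concave g -> log_concave (fun x => f x * g x).
Proof.
move=> f0 g0 /(log_concaveP f0) lf /(log_concaveP g0) lg.
apply/log_concaveP => [x|x y s s01]; first exact: mulr_ge0.
have H (z : 'rV[R]_n) : 0 < f z * g z -> 0 < f z /\ 0 < g z.
  move=> /lt0r_neq0; rewrite mulf_eq0 negb_or => /andP[fz gz].
  by rewrite !lt0r fz gz f0 g0.
move=> /H[fx gx] /H[fy gy].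
have [fz lfz] := lf _ _ _ s01 fx fy; have [gz lgz] := lg _ _ _ s01 gx gy.
split; first exact: mulr_gt0.
rewrite !lnM ?posrE// !mulrDr addrACA; exact: lerD.
Qed.

Lemma log_concave_cst (R : realType) n (c : R) : 0 < c ->
  log_concave (fun _ : 'rV[R]_n => c).
Proof.
move=> c0; apply/log_concaveP => [_|x y s _ _ _]; first exact: ltW.
by split=> //; rewrite -mulrDl subrKC mul1r.
Qed.

Lemma log_concave_affine (R : realType) n k (M : 'M[R]_(n, k)) (b : 'rV[R]_k)
    (f : 'rV[R]_k -> R) :
  log_concave f -> log_concave (fun y => f (y *m M + b)).
Proof.
move=> lf x y s s01; apply: le_trans (lf _ _ _ s01) _.
rewrite (_ : _ + (1 - s) *: _ = (s *: x + (1 - s) *: y) *m M + b)//.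
rewrite mulmxDl -!scalemxAl !scalerDr addrACA -scalerDl subrKC scale1r//.
Qed.

Lemma log_concave_gauss_weight (R : realType) n (t : R) : 0 <= t ->
  log_concave (@gauss_weight R n t).
Proof.
move=> t0; apply/log_concaveP => [x|x y s /andP[s0 s1] _ _]; first exact: expR_ge0.
split; first exact: expR_gt0.
rewrite /gauss_weight !expRK !mulNr !mulrN -opprD lerN2 !eucl_norm_sqr.
rewrite mulrCA [(1 - s) * _]mulrCA -mulrDr ler_wpM2l//; first by rewrite divr_ge0.
rewrite !mulr_sumr -big_split ler_sum//= => i _; rewrite !mxE.
rewrite -subr_ge0 (_ : _ - _ = s * (1 - s) * (x 0 i - y 0 i) ^+ 2); last by ring.
by rewrite mulr_ge0 ?sqr_ge0// mulr_ge0 ?ltW// subr_gt0.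
Qed.

Lemma gauss_tilt_has_density (R : realType) n (mu : probability 'rV[R]_n R)
    (f : 'rV[R]_n -> R) (t : R) : 0 <= t -> has_density mu f ->
  has_density (gauss_tilt mu t)
    (fun x => (fine (tiltZ mu t))^-1 * (f x * gauss_weight t x)).
Proof.
move=> t0 [mf f0 fE]; have Z0 : 0 <= (fine (tiltZ mu t))^-1.
  by rewrite invr_ge0 fine_ge0//; have /andP[/ltW] := tiltZ_bounds mu t0.
have mw := @measurable_gauss_weight R n t.
have w0 x : 0 <= @gauss_weight R n t x by exact: expR_ge0.
split.
- by apply: measurable_funM => //; exact: measurable_funM.
- by move=> x; rewrite mulr_ge0// mulr_ge0.
move=> A mA; rewrite gauss_tiltE// integral_mkcond.
rewrite (integral_density mf f0 fE); last first.
  by apply/(measurable_restrictT _ mA)/measurable_EFinP/measurable_funTS.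
rewrite [in RHS]integral_mkcond -ge0_integralZl//=.
- apply: eq_integral => x _; rewrite !patchE; case: ifP => _.
    by rewrite -!EFinM [f x * _]mulrC.
  by rewrite mul0e mule0.
- apply: emeasurable_funM; last exact/measurable_EFinP.
  by apply/(measurable_restrictT _ mA)/measurable_EFinP/measurable_funTS.
- move=> x _; rewrite patchE; case: ifP => _; last by rewrite mul0e.
  by rewrite mule_ge0 ?lee_fin.
Qed.

(** [y |-> y *m L^T + b] is the inverse of [phi]. *)
Lemma distribution_affine_has_density (R : realType) n
    (P : probability 'rV[R]_n R) (f : 'rV[R]_n -> R) (L : 'M[R]_n)
    (b : 'rV[R]_n) (phi : {mfun 'rV[R]_n >-> 'rV[R]_n}) :
  is_trig_mx L -> (forall i, 0 < L i i) ->
  (forall x, phi x = (x - b) *m (invmx L)^T) -> has_density P f ->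
  has_density (distribution P phi) (fun y => \det L * f (y *m L^T + b)).
Proof.
move=> trigL posL phiE [mf f0 fE].
have detL : 0 < \det L by rewrite det_trig// prodr_gt0.
have mS := measurable_affine L^T b.
have phiK y : phi (y *m L^T + b) = y.
  by rewrite phiE addrK -mulmxA -trmx_mul mulVmx ?trig_gt0_unitmx// trmx1 mulmx1.
split=> [|x|A mA].
- by apply: measurable_funM => //; exact: measurableT_comp mf mS.
- by rewrite mulr_ge0// ltW.
have mphiA : measurable (phi @^-1` A).
  by rewrite -[X in measurable X]setTI; exact: (measurable_funP phi).
rewrite [LHS](fE _ mphiA) integral_mkcond.
have mfA : measurable_fun setT ((fun x => (f x)%:E) \_ (phi @^-1` A)).
  by apply/(measurable_restrictT _ mphiA)/measurable_EFinP/measurable_funTS.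
have fA0 x : (0 <= ((fun x => (f x)%:E) \_ (phi @^-1` A)) x)%E.
  by rewrite patchE; case: ifP => // _; rewrite lee_fin.
have := integral_trig_affine trigL posL b mfA fA0.
move=> /(congr1 (fun z => ((\det L)%:E * z)%E)).
rewrite muleA -EFinM divff ?gt_eqF// mul1e => <-.
rewrite -ge0_integralZl//; last 2 first.
- exact: measurableT_comp mfA mS.
- by rewrite lee_fin ltW.
rewrite [RHS]integral_mkcond; apply: eq_integral => y _; rewrite !patchE.
rewrite (_ : (y *m L^T + b \in phi @^-1` A) = (y \in A)); last first.
  by apply/idP/idP; rewrite !inE /= phiK.
by case: ifP => _; rewrite ?mule0// EFinM.
Qed.

(** * Moments of the tilted measures *)

Section gauss_weight.
Context {R : realType} {n : nat}.
Implicit Types (x : 'rV[R]_n) (s t : R).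

Lemma gauss_weight_gt0 t x : 0 < gauss_weight t x.
Proof. exact: expR_gt0. Qed.

Lemma gauss_weight_le1 t x : 0 <= t -> gauss_weight t x <= 1.
Proof.
move=> t0; rewrite -expR0 ler_expR mulNr oppr_le0 mulr_ge0 ?sqr_ge0//.
by rewrite divr_ge0.
Qed.

Lemma gauss_weight0 x : gauss_weight 0 x = 1.
Proof. by rewrite /gauss_weight mul0r oppr0 mul0r expR0. Qed.

Lemma gauss_weightD s t x :
  gauss_weight (s + t) x = gauss_weight s x * gauss_weight t x.
Proof. by rewrite /gauss_weight -expRD; congr expR; lra. Qed.

Lemma gauss_weight_le s t x : s <= t -> gauss_weight t x <= gauss_weight s x.
Proof.
move=> st; rewrite ler_expR !mulNr lerN2 ler_wpM2r ?sqr_ge0// ler_wpM2r//.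
Qed.

(** Measurable functions whose product with every Gaussian weight is bounded.
    They form an algebra that contains the coordinates, hence the polynomials,
    and they are integrable under [mu_t] for every [t > 0], whatever [mu] is. *)
Definition tame (g : 'rV[R]_n -> R) : Prop :=
  measurable_fun setT g /\
  forall t, 0 < t -> exists K, forall x, `|g x| * gauss_weight t x <= K.

Lemma tame_measurable g : tame g -> measurable_fun setT g. Proof. by case. Qed.

Lemma tame_cst c : tame (fun=> c).
Proof.
split=> [//|t t0]; exists `|c| => x.
by rewrite ler_piMr// gauss_weight_le1// ltW.
Qed.

Lemma tameD f g : tame f -> tame g -> tame (fun x => f x + g x).
Proof.
move=> [mf ff] [mg gg]; split=> [|t t0]; first exact: measurable_funD.
have [K fK] := ff _ t0; have [K' gK] := gg _ t0.
exists (K + K') => x; apply: le_trans (lerD (fK x) (gK x)).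
by rewrite -mulrDl ler_wpM2r ?ler_normD// ltW// gauss_weight_gt0.
Qed.

Lemma tameM f g : tame f -> tame g -> tame (fun x => f x * g x).
Proof.
move=> [mf ff] [mg gg]; split=> [|t t0]; first exact: measurable_funM.
have t20 : 0 < t / 2 by rewrite divr_gt0.
have [K fK] := ff _ t20; have [K' gK] := gg _ t20.
exists (K * K') => x; rewrite [t]splitr gauss_weightD normrM mulrACA.
by apply: ler_pM => //; rewrite mulr_ge0// ltW// gauss_weight_gt0.
Qed.

Lemma tameN f : tame f -> tame (fun x => - f x).
Proof.
move=> /(tameM (tame_cst (-1))).
by congr tame; apply/funext => x; rewrite mulN1r.
Qed.

Lemma tameB f g : tame f -> tame g -> tame (fun x => f x - g x).
Proof. by move=> tf tg; apply: tameD => //; exact: tameN. Qed.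

Lemma tame_sum I (r : seq I) (F : I -> 'rV[R]_n -> R) :
  (forall i, tame (F i)) -> tame (fun x => \sum_(i <- r) F i x).
Proof.
move=> tF; elim: r => [|i r IHr].
  by under eq_fun do rewrite big_nil; exact: tame_cst.
by under eq_fun do rewrite big_cons; exact: tameD.
Qed.

Lemma tame_coord i : tame (fun x => x 0 i).
Proof.
split=> [|t t0]; first exact: measurable_coord.
exists (1 + 2 / t) => x; set q := eucl_norm x ^+ 2.
have xq : `|x 0 i| <= 1 + q.
  have : x 0 i ^+ 2 <= q.
    rewrite /q eucl_norm_sqr (bigD1 i)//= lerDl sumr_ge0// => j _.
    exact: sqr_ge0.
  rewrite -(real_normK (num_real (x 0 i))).
  have := sqr_ge0 (eucl_norm x); rewrite -/q.
  by have := sqr_ge0 (`|x 0 i| - 1); rewrite sqrrB1 => *; lra.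
have w0 := gauss_weight_gt0 t x.
apply: le_trans (ler_wpM2r (ltW w0) xq) _.
rewrite mulrDl mul1r lerD ?gauss_weight_le1 ?(ltW t0)//.
rewrite ler_pdivlMr// /gauss_weight -/q mulNr expRN.
rewrite -mulrA [_^-1 * t]mulrC mulrA ler_pdivrMr ?expR_gt0//.
have := expR_ge1Dx (t / 2 * q); lra.
Qed.

Lemma tame_eucl_norm : tame (fun x => eucl_norm x ^+ 2).
Proof.
rewrite (_ : (fun x => _) = fun x : 'rV[R]_n => \sum_i x 0 i * x 0 i).
  by apply: tame_sum => i; apply: tameM; exact: tame_coord.
by apply/funext => x; rewrite eucl_norm_sqr; under eq_bigr do rewrite expr2.
Qed.

Lemma tame_affine k (M : 'M[R]_(n, k)) (m : 'rV[R]_n) i :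
  tame (fun x => ((x - m) *m M) 0 i).
Proof.
rewrite (_ : (fun x => _) = fun x => \sum_j (x 0 j - m 0 j) * M j i).
  apply: tame_sum => j; apply: tameM; last exact: tame_cst.
  by apply: tameB; [exact: tame_coord|exact: tame_cst].
by apply/funext => x; rewrite mxE; under eq_bigr do rewrite !mxE.
Qed.

End gauss_weight.

Section tilted_moments.
Context {R : realType} {n : nat} (mu : probability 'rV[R]_n R).
Implicit Types (f g : 'rV[R]_n -> R) (t : R).

(** The unnormalised moment [\int g w_t dmu], as a real number. *)
Definition gaussint t g : R := \int[mu]_x (g x * gauss_weight t x).

(** The expectation of [g] under [mu_t]; it is used as such for tame [g] and
    [t > 0] (lemma [expectation_gauss_tilt]). *)
Definition tiltexp t g : R := gaussint t g / gaussint t (fun=> 1).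

Lemma tame_integrable t g : 0 < t -> tame g ->
  mu.-integrable setT (EFin \o (fun x => g x * gauss_weight t x)).
Proof.
move=> t0 [mg tg]; have [K gK] := tg _ t0.
apply: (le_integrable measurableT _ _ (finite_measure_integrable_cst mu K measurableT)).
  apply/measurable_EFinP/measurable_funM => //.
  exact: measurable_gauss_weight.
move=> x _ /=; rewrite lee_fin normrM (gtr0_norm (gauss_weight_gt0 _ _)).
exact: le_trans (gK x) (ler_norm _).
Qed.

Lemma gaussint1E t : gaussint t (fun=> 1) = fine (tiltZ mu t).
Proof.
by congr fine; apply: eq_integral => x _; rewrite mul1r.
Qed.

Lemma gaussint1_gt0 t : 0 <= t -> 0 < gaussint t (fun=> 1).
Proof.
move=> /(tiltZ_bounds mu)/andP[Z0 Z1]; rewrite gaussint1E fine_gt0// Z0/=.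
exact: le_lt_trans Z1 (ltry _).
Qed.

Lemma gaussint1_le1 t : 0 <= t -> gaussint t (fun=> 1) <= 1.
Proof.
move=> t0; have /andP[Z0 Z1] := tiltZ_bounds mu t0.
rewrite gaussint1E -lee_fin fineK// ge0_fin_numE ?(ltW Z0)//.
exact: le_lt_trans Z1 (ltry _).
Qed.

Lemma gaussintD t f g : 0 < t -> tame f -> tame g ->
  gaussint t (fun x => f x + g x) = gaussint t f + gaussint t g.
Proof.
move=> t0 tf tg; rewrite /gaussint.
under eq_Rintegral do rewrite mulrDl.
by rewrite RintegralD//; exact: tame_integrable.
Qed.

Lemma gaussintZ t c f : 0 < t -> tame f -> gaussint t (fun x => c * f x) = c * gaussint t f.
Proof.
move=> t0 tf; rewrite /gaussint.
under eq_Rintegral do rewrite -mulrA.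
by rewrite RintegralZl//; exact: tame_integrable.
Qed.

Lemma tiltexpD t f g : 0 < t -> tame f -> tame g ->
  tiltexp t (fun x => f x + g x) = tiltexp t f + tiltexp t g.
Proof. by move=> *; rewrite /tiltexp gaussintD// mulrDl. Qed.

Lemma tiltexpZ t c f : 0 < t -> tame f ->
  tiltexp t (fun x => c * f x) = c * tiltexp t f.
Proof. by move=> *; rewrite /tiltexp gaussintZ// mulrA. Qed.

Lemma tiltexp_cst t c : 0 < t -> tiltexp t (fun=> c) = c.
Proof.
move=> t0; transitivity (tiltexp t (fun=> c * 1)).
  by congr tiltexp; apply/funext => x; rewrite mulr1.
rewrite tiltexpZ//; last exact: tame_cst.
by rewrite /tiltexp divff ?mulr1// gt_eqF// gaussint1_gt0// ltW.
Qed.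

Lemma tiltexp_sum t I (r : seq I) (F : I -> 'rV[R]_n -> R) : 0 < t ->
  (forall i, tame (F i)) ->
  tiltexp t (fun x => \sum_(i <- r) F i x) = \sum_(i <- r) tiltexp t (F i).
Proof.
move=> t0 tF; elim: r => [|i r IHr].
  by under eq_fun do rewrite big_nil; rewrite big_nil tiltexp_cst.
under eq_fun do rewrite big_cons.
by rewrite big_cons tiltexpD ?IHr//; exact: tame_sum.
Qed.

Lemma tiltexp_ge0 t g : 0 <= t -> (forall x, 0 <= g x) -> 0 <= tiltexp t g.
Proof.
move=> t0 g0; rewrite divr_ge0 ?(ltW (gaussint1_gt0 _))//.
by apply: Rintegral_ge0 => x _; rewrite mulr_ge0// ltW// gauss_weight_gt0.
Qed.

Lemma gauss_tilt_integral t (g : 'rV[R]_n -> \bar R) : 0 <= t ->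
  measurable_fun setT g ->
  (\int[gauss_tilt mu t]_x g x =
   \int[mu]_x (g x * ((gaussint t (fun=> 1))^-1 * gauss_weight t x)%:E))%E.
Proof.
move=> t0 mg; apply: (@integral_density _ _ _ mu) => //.
- apply: measurable_funM => //; exact: measurable_gauss_weight.
- by move=> x; rewrite mulr_ge0 ?invr_ge0// ltW ?gaussint1_gt0 ?gauss_weight_gt0.
move=> A mA; rewrite gauss_tiltE// gaussint1E -ge0_integralZl//.
- apply/measurable_EFinP/measurable_funTS; exact: measurable_gauss_weight.
- by move=> x _; rewrite lee_fin ltW// gauss_weight_gt0.
- by rewrite lee_fin invr_ge0 -gaussint1E ltW// gaussint1_gt0.
Qed.

Lemma expectation_gauss_tilt t g : 0 < t -> tame g ->
  ('E_(gauss_tilt mu t)[g] = (tiltexp t g)%:E)%E.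
Proof.
move=> t0 tg; rewrite unlock gauss_tilt_integral ?(ltW t0)//; last first.
  by apply/measurable_EFinP; exact: tame_measurable.
under eq_integral => x _ do rewrite -EFinM mulrCA EFinM.
have ig := tame_integrable t0 tg.
rewrite integralZl// /tiltexp mulrC EFinM fineK//.
exact: integrable_fin_num.
Qed.

Lemma covariance_gauss_tilt t f g : 0 < t -> tame f -> tame g ->
  covariance (gauss_tilt mu t) f g =
  (tiltexp t (fun x => f x * g x) - tiltexp t f * tiltexp t g)%:E.
Proof.
move=> t0 tf tg; rewrite unlock !expectation_gauss_tilt//=; last first.
  by apply: tameM; apply: tameB => //; exact: tame_cst.
congr EFin; set a := tiltexp t f; set b := tiltexp t g.
transitivity (tiltexp t (fun x => f x * g x + (- b * f x + (- a * g x + a * b)))).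
  congr tiltexp; apply/funext => x.
  by transitivity ((f x - a) * (g x - b)); [|ring].
have tZ c h : tame h -> tame (fun x => c * h x).
  by move=> th; apply: tameM => //; exact: tame_cst.
have tc := @tame_cst R n.
rewrite !tiltexpD//; do ?[exact: tameM|exact: tameD|exact: tZ|exact: tame_cst].
- by rewrite (tiltexp_cst (a * b) t0) (tiltexpZ _ t0 tf) (tiltexpZ _ t0 tg) -/a -/b; ring.
- by apply: tameD; [exact: tZ|exact: tame_cst].
- by apply: tameD; [exact: tZ|apply: tameD; [exact: tZ|exact: tame_cst]].
Qed.

End tilted_moments.

(** * Calculus: monotonicity by touching, and moments as functions of the time *)

Lemma continuous_bigsum (R : realType) I (r : seq I) (F : I -> R -> R) :
  (forall i, continuous (F i)) -> continuous (fun t => \sum_(i <- r) F i t).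
Proof.
move=> cF; elim: r => [|i r IHr] t.
  by under eq_fun do rewrite big_nil; exact: cvg_cst.
by under eq_fun do rewrite big_cons; apply: cvgD; [exact: cF|exact: IHr].
Qed.

Lemma continuous_bigprod (R : realType) I (r : seq I) (F : I -> R -> R) :
  (forall i, continuous (F i)) -> continuous (fun t => \prod_(i <- r) F i t).
Proof.
move=> cF; elim: r => [|i r IHr] t.
  by under eq_fun do rewrite big_nil; exact: cvg_cst.
by under eq_fun do rewrite big_cons; apply: cvgM; [exact: cF|exact: IHr].
Qed.

Lemma continuous_det (R : realType) n (A : R -> 'M[R]_n) :
  (forall i j, continuous (fun t => A t i j)) -> continuous (fun t => \det (A t)).
Proof.
move=> cA; apply: continuous_bigsum => s t.
apply: cvgM; first exact: cvg_cst.
exact: continuous_bigprod.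
Qed.

(** If [h] had [h a < h b], subtracting from [h] a linear function of small
    positive slope [e] would give a function whose maximum is attained at some
    [s > a]; to the left of [s] the difference quotients of [phi] at [s] would
    be at least [e], against [d <= 0]. *)
Lemma nonincreasing_touch (R : realType) (h : R -> R) (a b : R) : a < b ->
  {within `[a, b], continuous h} ->
  (forall s, a < s <= b -> exists (phi : R -> R) (d : R),
     [/\ is_derive s (1 : R) phi d, d <= 0 &
     forall r, a < r < s -> phi r - phi s <= h r - h s]) ->
  h b <= h a.
Proof.
move=> ab ch touch; rewrite leNgt; apply/negP => hab.
(* Half the mean slope of [h] on [[a, b]]. *)
pose e := (h b - h a) / (b - a) / 2.
have e0 : 0 < e by rewrite !divr_gt0// subr_gt0.
have ce : {within `[a, b], continuous (fun x => h x - e * x)}.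
  move=> x; apply: cvgB; first exact: ch.
  apply: continuous_subspaceT => {}x.
  by apply: cvgM; [exact: cvg_cst|exact: cvg_id].
have [s sab smax] := EVT_max (ltW ab) ce.
have bab : b \in `[a, b] by rewrite in_itv/= lexx ltW.
have sa : a < s.
  move: sab; rewrite in_itv/= le_eqVlt => /andP[/predU1P[sE|//] _].
  have := smax _ bab; rewrite -sE leNgt => /negP; case.
  rewrite -subr_gt0.
  rewrite (_ : _ - _ = (h b - h a) - e * (b - a)); last by ring.
  have -> : e * (b - a) = (h b - h a) / 2.
    by rewrite /e; field; rewrite subr_eq0 gt_eqF.
  by have : 0 < h b - h a by [rewrite subr_gt0]; lra.
have sb : s <= b by move: sab; rewrite in_itv => /andP[].
have [|phi [d [dphi d0 tphi]]] := touch s; first by rewrite sa.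
have /cvgrPdist_lt/(_ e e0) : h^-1 *: (phi (h + s) - phi s) @[h --> 0^'] --> d.
  have [/cvg_ex[l phil] <-] := dphi.
  move: phil; under eq_fun do rewrite scaler1.
  by move=> phil; rewrite /derive; under eq_fun do rewrite scaler1; apply: cvgP phil.
rewrite near_withinE => /nbhs_ballP[r /= r0 rP].
(* A left increment small enough for the difference quotient of [phi] and for
   [s - k] to stay in []a, s[]. *)
pose k := Num.min (r / 2) ((s - a) / 2).
have sa0 : 0 < s - a by rewrite subr_gt0.
have k0 : 0 < k by rewrite lt_min !divr_gt0.
have kr : k < r by rewrite gt_min ltr_pdivrMr// ltr_pMr// ltr1n.
have ks : k < s - a by rewrite gt_min [X in _ || X]ltr_pdivrMr// ltr_pMr// ltr1n orbT.
have := rP (- k); rewrite /ball/= sub0r opprK gtr0_norm// => /(_ kr).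
rewrite oppr_eq0 gt_eqF// => /(_ isT).
set w := phi (- k + s) - phi s => dw.
have w1 : w <= - (e * k).
  have sk : a < s - k < s by lra.
  have := tphi _ sk; rewrite [s - k]addrC -/w => /le_trans; apply.
  have := smax (- k + s); rewrite in_itv/= => /(_ _)/wrap[|]; first lra.
  by move=> H; lra.
have : e <= (- k)^-1 *: w.
  by rewrite invrN scaleNr -scalerN /GRing.scale/= mulrC ler_pdivlMr// lerNr.
move: dw; rewrite ltr_distlC => /andP[]; lra.
Qed.

Section moment_calculus.
Context {R : realType} {n : nat} (mu : probability 'rV[R]_n R).
Implicit Types (f g : 'rV[R]_n -> R) (t : R).

Lemma is_derive_gauss_weight (x : 'rV[R]_n) t :
  is_derive t (1 : R) (fun t => gauss_weight t x)
    (- (eucl_norm x ^+ 2 / 2) * gauss_weight t x).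
Proof.
set c := - (_ / 2).
have E u : gauss_weight u x = expR (c * u).
  by rewrite /gauss_weight /c; congr expR; ring.
rewrite (_ : (fun t => _) = expR \o (fun u => c * u)); last first.
  by apply/funext => u; rewrite E.
rewrite E mulrC; apply: is_derive1_comp.
by apply: is_derive_eq; rewrite scaler1.
Qed.

Lemma is_derive_gaussint (s : R) g : 0 < s -> tame g ->
  is_derive s (1 : R) (fun t => gaussint mu t g)
    (- (gaussint mu s (fun x => g x * eucl_norm x ^+ 2) / 2)).
Proof.
move=> s0 tg; pose q (x : 'rV[R]_n) := eucl_norm x ^+ 2.
have tq : tame q by exact: tame_eucl_norm.
have ts : tame (fun x => g x * q x) by exact: tameM.
pose f t x := g x * gauss_weight t x.
have df t x : is_derive t (1 : R) (f ^~ x) (- (g x * q x / 2) * gauss_weight t x).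
  have dw := is_derive_gauss_weight x t.
  apply: is_derive_eq.
  by rewrite /GRing.scale/= /q; ring.
have d1f t x : partial1of2 f t x = - (g x * q x / 2) * gauss_weight t x.
  by rewrite partial1of2E; case: (df t x).
pose G x := `|g x * q x| * gauss_weight (s / 2) x.
have G0 x : 0 <= G x by rewrite mulr_ge0// ltW// gauss_weight_gt0.
(* For [t > s / 2] the derivative in [t] of the integrand is dominated by [G]. *)
have s20 : 0 < s / 2 by rewrite divr_gt0.
have Is : [set` `]s / 2, s + 1[] s by rewrite /= in_itv/=; lra.
have intf t : [set` `]s / 2, s + 1[] t -> mu.-integrable setT (EFin \o f t).
  rewrite /= in_itv/= => /andP[t0 _]; apply: tame_integrable => //.
  exact: lt_trans t0.
have intG : mu.-integrable setT (EFin \o G).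
  have := integrable_abse (tame_integrable mu s20 ts).
  apply: eq_integrable => // x _ /=.
  by rewrite normrM [X in _ * X]gtr0_norm// gauss_weight_gt0.
have derf t x : [set` `]s / 2, s + 1[] t -> setT x -> derivable (f ^~ x) t 1.
  by move=> _ _; case: (df t x).
have Gub t x : [set` `]s / 2, s + 1[] t -> setT x -> `|partial1of2 f t x| <= G x.
  rewrite /= in_itv/= => /andP[t0 _] _; rewrite d1f /G normrM normrN.
  rewrite [X in _ * X]gtr0_norm ?gauss_weight_gt0//.
  apply: ler_pM => //; first by rewrite ltW// gauss_weight_gt0.
    rewrite normrM [X in _ * X]gtr0_norm ?invr_gt0// ler_pdivrMr// ler_peMr//.
    by rewrite ler1n.
  by apply: gauss_weight_le; exact: ltW.
apply: DeriveDef.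
  exact: (derivable_under_integral measurableT Is intf derf G0 intG Gub).
rewrite -derive1E (differentiation_under_integral measurableT Is intf derf G0 intG Gub).
under eq_Rintegral do rewrite d1f.
rewrite -[RHS]mulN1r mulrCA [-1 * _]mulN1r mulrC /gaussint -RintegralZl//; last first.
  exact: tame_integrable.
by apply: eq_Rintegral => x _; rewrite /q; ring.
Qed.

(** [d/dt E_t g = - Cov_t (g, |x|^2) / 2]. *)
Lemma is_derive_tiltexp (s : R) g : 0 < s -> tame g ->
  is_derive s (1 : R) (fun t => tiltexp mu t g)
    (- ((tiltexp mu s (fun x => g x * eucl_norm x ^+ 2) -
       tiltexp mu s g * tiltexp mu s (fun x => eucl_norm x ^+ 2)) / 2)).
Proof.
move=> s0 tg; have Z0 := gaussint1_gt0 mu (ltW s0).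
have dg := is_derive_gaussint s0 tg.
have dZ := is_derive_gaussint s0 (@tame_cst R n 1).
have Zn0 : gaussint mu s (fun=> 1) != 0 by rewrite gt_eqF.
have dV := is_deriveV Zn0 dZ.
rewrite (_ : (fun t => _) =
  (fun t => gaussint mu t g) * (fun t => (gaussint mu t (fun=> 1))^-1))//.
apply: is_derive_eq; rewrite /tiltexp /GRing.scale/=.
rewrite (_ : (fun x => 1 * _) = (fun x : 'rV[R]_n => eucl_norm x ^+ 2)); last first.
  by apply/funext => x; rewrite mul1r.
by field.
Qed.

(** The absolute value extends the moments, which are considered for [t >= 0],
    to a continuous function on the whole line. *)
Lemma continuous_gaussint g : mu.-integrable setT (EFin \o g) ->
  continuous (fun t => gaussint mu `|t| g).
Proof.
move=> ig t; pose f t x := g x * gauss_weight `|t| x.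
have mg : measurable_fun setT g by apply/measurable_EFinP; exact: (measurable_int mu).
have intf t' : [set` `]t - 1, t + 1[] t' -> mu.-integrable setT (EFin \o f t').
  move=> _; apply: le_integrable ig => //.
    apply/measurable_EFinP/measurable_funM => //; exact: measurable_gauss_weight.
  move=> x _ /=; rewrite lee_fin normrM ler_piMr//.
  by rewrite gtr0_norm ?gauss_weight_gt0// gauss_weight_le1.
have := @continuity_under_integral R _ _ mu f setT measurableT (t - 1) (t + 1) intf _
  (fun x => `|g x|).
apply; last by rewrite inE /= in_itv/=; lra.
- apply/aeW => x _ t' _.
  apply: cvgM; first exact: cvg_cst.
  rewrite /gauss_weight; apply: continuous_cvg; first exact: continuous_expR.
  apply: cvgM; last exact: cvg_cst.
  apply: cvgN; apply: cvgM; last exact: cvg_cst.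
  exact: norm_continuous.
- by have := integrable_abse ig; apply: eq_integrable.
- move=> t' _; apply/aeW => x _; rewrite normrM ler_piMr//.
  by rewrite gtr0_norm ?gauss_weight_gt0// gauss_weight_le1.
Qed.

Lemma continuous_tiltexp g : mu.-integrable setT (EFin \o g) ->
  continuous (fun t => tiltexp mu `|t| g).
Proof.
move=> ig t; apply: cvgM; first exact: continuous_gaussint.
apply: cvgV; first by rewrite gt_eqF// gaussint1_gt0.
apply: continuous_gaussint; exact: (finite_measure_integrable_cst mu 1).
Qed.

End moment_calculus.

(** * Covariances of the tilted measures *)

Section tilted_covariance.
Context {R : realType} {n : nat} (mu : probability 'rV[R]_n R).
Implicit Types (f g h : 'rV[R]_n -> R) (t : R).

(** The covariance of [f] and [g] under [mu_t]. *)
Definition tilt_cov t f g : R :=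
  tiltexp mu t (fun x => f x * g x) - tiltexp mu t f * tiltexp mu t g.

(** The barycentre of [mu_t]. *)
Definition tilt_mean t : 'rV[R]_n := \row_i tiltexp mu t (fun x => x 0 i).

(** The covariance matrix [A_t] of [mu_t]. It is given by explicit
    integrals with respect to [mu], and its value at [t = 0] is the covariance
    matrix of [mu] itself. *)
Definition tilt_cov_mx t : 'M[R]_n :=
  \matrix_(i, j) tilt_cov t (fun x => x 0 i) (fun x => x 0 j).

Lemma tilt_covC t f g : tilt_cov t f g = tilt_cov t g f.
Proof.
rewrite /tilt_cov mulrC; congr (tiltexp _ _ _ - _).
by apply/funext => x; rewrite mulrC.
Qed.

Lemma tilt_covDl t f g h : 0 < t -> tame f -> tame g -> tame h ->
  tilt_cov t (fun x => f x + g x) h = tilt_cov t f h + tilt_cov t g h.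
Proof.
move=> t0 tf tg th; rewrite /tilt_cov (tiltexpD mu t0 tf tg).
under eq_fun do rewrite mulrDl.
by rewrite tiltexpD//; [ring|exact: tameM|exact: tameM].
Qed.

Lemma tilt_covZl t c f h : 0 < t -> tame f -> tame h ->
  tilt_cov t (fun x => c * f x) h = c * tilt_cov t f h.
Proof.
move=> t0 tf th; rewrite /tilt_cov (tiltexpZ mu c t0 tf).
under eq_fun do rewrite -mulrA.
by rewrite tiltexpZ//; [ring|exact: tameM].
Qed.

Lemma tilt_cov_cstl t c h : 0 < t -> tame h -> tilt_cov t (fun=> c) h = 0.
Proof. by move=> t0 th; rewrite /tilt_cov tiltexp_cst// tiltexpZ// subrr. Qed.

Lemma tilt_cov_suml t I (r : seq I) (F : I -> 'rV[R]_n -> R) h : 0 < t ->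
  (forall i, tame (F i)) -> tame h ->
  tilt_cov t (fun x => \sum_(i <- r) F i x) h = \sum_(i <- r) tilt_cov t (F i) h.
Proof.
move=> t0 tF th; elim: r => [|i r IHr].
  by under eq_fun do rewrite big_nil; rewrite big_nil tilt_cov_cstl.
under eq_fun do rewrite big_cons.
by rewrite big_cons tilt_covDl ?IHr//; exact: tame_sum.
Qed.

Lemma tilt_covE t f : 0 < t -> tame f ->
  tilt_cov t f f = tiltexp mu t (fun x => (f x - tiltexp mu t f) ^+ 2).
Proof.
move=> t0 tf; set c := tiltexp mu t f.
rewrite (_ : (fun x => _) = fun x => f x * f x + ((- (c *+ 2)) * f x + c ^+ 2)); last first.
  by apply/funext => x; ring.
have tc := @tame_cst R n.
rewrite tiltexpD//; last 2 first.
- exact: tameM.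
- by apply: tameD => //; exact: tameM.
rewrite tiltexpD//; last exact: tameM.
by rewrite (tiltexp_cst mu _ t0) (tiltexpZ mu _ t0 tf) /tilt_cov -/c; ring.
Qed.

Lemma tilt_cov_ge0 t f : 0 < t -> tame f -> 0 <= tilt_cov t f f.
Proof.
by move=> t0 tf; rewrite tilt_covE// tiltexp_ge0 ?(ltW t0)// => x; rewrite sqr_ge0.
Qed.

Lemma tilt_cov_affine t k (M : 'M[R]_(n, k)) (m : 'rV[R]_n) i j : 0 < t ->
  tilt_cov t (fun x => ((x - m) *m M) 0 i) (fun x => ((x - m) *m M) 0 j) =
  (M^T *m tilt_cov_mx t *m M) i j.
Proof.
move=> t0.
have H h (l : 'I_k) : tame h -> tilt_cov t (fun x => ((x - m) *m M) 0 l) h =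
    \sum_a M a l * tilt_cov t (fun x => x 0 a) h.
  move=> th; rewrite (_ : (fun x => _) =
      fun x : 'rV[R]_n => \sum_a M a l * (x 0 a + - m 0 a)); last first.
    by apply/funext => x; rewrite mxE; apply: eq_bigr => a _; rewrite !mxE mulrC.
  have tx a : tame (fun x : 'rV[R]_n => x 0 a + - m 0 a).
    by apply: tameD; [exact: tame_coord|exact: tame_cst].
  rewrite tilt_cov_suml// => [|a]; last by apply: tameM => //; exact: tame_cst.
  apply: eq_bigr => a _; rewrite tilt_covZl// tilt_covDl//; last 2 first.
  - exact: tame_coord.
  - exact: tame_cst.
  by rewrite tilt_cov_cstl// addr0.
rewrite H; last exact: tame_affine.
rewrite -mulmxA mxE; apply: eq_bigr => a _; rewrite !mxE tilt_covC H; last exact: tame_coord.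
congr (_ * _); apply: eq_bigr => b _; rewrite mxE mulrC; congr (_ * _).
exact: tilt_covC.
Qed.

Lemma tiltexp_affine t k (M : 'M[R]_(n, k)) i : 0 < t ->
  tiltexp mu t (fun x => ((x - tilt_mean t) *m M) 0 i) = 0.
Proof.
move=> t0; rewrite (_ : (fun x => _) =
    fun x : 'rV[R]_n => \sum_a M a i * (x 0 a + - tilt_mean t 0 a)); last first.
  by apply/funext => x; rewrite mxE; apply: eq_bigr => a _; rewrite !mxE mulrC.
have tx a : tame (fun x : 'rV[R]_n => x 0 a + - tilt_mean t 0 a).
  by apply: tameD; [exact: tame_coord|exact: tame_cst].
rewrite tiltexp_sum// => [|a]; last by apply: tameM => //; exact: tame_cst.
apply: big1 => a _; rewrite tiltexpZ// tiltexpD//; last 2 first.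
- exact: tame_coord.
- exact: tame_cst.
by rewrite tiltexp_cst// mxE subrr mulr0.
Qed.

Lemma cov_mx_gauss_tilt t : 0 < t -> cov_mx (gauss_tilt mu t) = tilt_cov_mx t.
Proof.
move=> t0; apply/matrixP => i j; rewrite !mxE covariance_gauss_tilt//;
  exact: tame_coord.
Qed.

Lemma tiltexp_eucl_norm t : 0 < t ->
  tiltexp mu t (fun x => eucl_norm x ^+ 2) =
  \sum_i tiltexp mu t (fun x => x 0 i * x 0 i).
Proof.
move=> t0; rewrite -tiltexp_sum// => [|i]; last by apply: tameM; exact: tame_coord.
congr tiltexp; apply/funext => x; rewrite eucl_norm_sqr.
by apply: eq_bigr => i _; rewrite expr2.
Qed.

Lemma mxtrace_second_moment_mx t : 0 < t ->
  \tr (second_moment_mx (gauss_tilt mu t)) =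
  tiltexp mu t (fun x => eucl_norm x ^+ 2).
Proof.
move=> t0; rewrite tiltexp_eucl_norm//; apply: eq_bigr => i _.
by rewrite !mxE expectation_gauss_tilt//; apply: tameM; exact: tame_coord.
Qed.

Lemma mxtrace_tilt_cov_mx_le t : 0 < t ->
  \tr (tilt_cov_mx t) <= tiltexp mu t (fun x => eucl_norm x ^+ 2).
Proof.
move=> t0; rewrite tiltexp_eucl_norm// ler_sum// => i _.
by rewrite mxE /tilt_cov lerBlDr lerDl -expr2 sqr_ge0.
Qed.

Hypothesis iso : isotropic mu.

(** The diagonal covariances are 1, and a truncated value can only be 1 if the
    integral is finite; so the second moments are finite. *)
Lemma isotropic_integralM i j :
  mu.-integrable setT (EFin \o (fun x : 'rV[R]_n => x 0 i * x 0 j)) /\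
  \int[mu]_x (x 0 i * x 0 j) = (i == j)%:R.
Proof.
have [m0 c1] := iso.
have cE k l : fine (\int[mu]_x (x 0 k * x 0 l)%:E)%E = (k == l)%:R.
  have /matrixP/(_ k l) := c1; rewrite !mxE unlock => <-.
  have mE (k' : 'I_n) : fine ('E_mu[fun x : 'rV[R]_n => (x 0 k')%R])%E = 0.
    by have /rowP/(_ k') := m0; rewrite !mxE.
  rewrite !mE unlock; congr fine; apply: eq_integral => x _; congr EFin.
  by transitivity ((x 0 k - 0) * (x 0 l - 0)); [rewrite !subr0|].
have m2 k l : measurable_fun setT (fun x : 'rV[R]_n => x 0 k * x 0 l).
  by apply: measurable_funM; exact: measurable_coord.
have i2 k : mu.-integrable setT (EFin \o (fun x : 'rV[R]_n => x 0 k * x 0 k)).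
  apply/integrableP; split; first exact/measurable_EFinP.
  have xx (x : 'rV[R]_n) : `|x 0 k * x 0 k| = x 0 k * x 0 k.
    by rewrite ger0_norm// -expr2 sqr_ge0.
  under eq_integral => x _ do rewrite /= xx.
  have := cE k k; rewrite eqxx; case: (integral _ _ _) => [r _|/eqP|/eqP] /=.
  - exact: ltry.
  - by rewrite eq_sym oner_eq0.
  - by rewrite eq_sym oner_eq0.
split; last exact: cE.
apply: (le_integrable measurableT _ _ (integrableD measurableT (i2 i) (i2 j))).
  exact/measurable_EFinP.
move=> x _ /=; rewrite lee_fin [leRHS]ger0_norm; last first.
  by rewrite addr_ge0// -expr2 sqr_ge0.
rewrite ler_norml; have := sqr_ge0 (x 0 i + x 0 j); have := sqr_ge0 (x 0 i - x 0 j).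
have := sqr_ge0 (x 0 i); have := sqr_ge0 (x 0 j).
by rewrite sqrrB sqrrD !expr2 => *; apply/andP; split; lra.
Qed.

Lemma isotropic_integral i :
  mu.-integrable setT (EFin \o (fun x : 'rV[R]_n => x 0 i)) /\
  \int[mu]_x x 0 i = 0.
Proof.
have [m0 _] := iso; split; last first.
  by have /rowP/(_ i) := m0; rewrite !mxE unlock.
have [i2 _] := isotropic_integralM i i.
have i1 := finite_measure_integrable_cst mu 1 measurableT.
apply: (le_integrable measurableT _ _ (integrableD measurableT i1 i2)).
  by apply/measurable_EFinP; exact: measurable_coord.
move=> x _ /=; rewrite lee_fin [leRHS]ger0_norm; last first.
  by rewrite addr_ge0// -expr2 sqr_ge0.
rewrite ler_norml; have := sqr_ge0 (x 0 i + 1); have := sqr_ge0 (x 0 i - 1).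
have := sqr_ge0 (x 0 i).
by rewrite sqrrB sqrrD !expr2 => *; apply/andP; split; lra.
Qed.

Lemma tiltexp0 g : tiltexp mu 0 g = \int[mu]_x g x.
Proof.
have g0 h : gaussint mu 0 h = \int[mu]_x h x.
  by apply: eq_Rintegral => x _; rewrite gauss_weight0 mulr1.
rewrite /tiltexp !g0 Rintegral_cst// mul1r.
by rewrite (_ : fine (mu setT) = 1) ?divr1// probability_setT.
Qed.

Lemma tilt_cov_mx0 : tilt_cov_mx 0 = 1%:M.
Proof.
apply/matrixP => i j; rewrite !mxE /tilt_cov !tiltexp0.
have [_ ->] := isotropic_integralM i j.
by have [_ ->] := isotropic_integral i; rewrite mul0r subr0.
Qed.

Lemma continuous_tilt_cov_mx i j : continuous (fun t => tilt_cov_mx `|t| i j).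
Proof.
have [i1 _] := isotropic_integral i; have [j1 _] := isotropic_integral j.
have [i2 _] := isotropic_integralM i j.
rewrite (_ : (fun t => _) = fun t : R => tiltexp mu `|t| (fun x => x 0 i * x 0 j) -
    tiltexp mu `|t| (fun x => x 0 i) * tiltexp mu `|t| (fun x => x 0 j)); last first.
  by apply/funext => t; rewrite mxE.
move=> t; apply: cvgB; first exact: continuous_tiltexp.
by apply: cvgM; exact: continuous_tiltexp.
Qed.

(** If a linear form were almost surely constant under [mu_t], it would be so
    under [mu], as the Gaussian weight is positive; isotropy of [mu] excludes
    this. *)
Lemma posdefmx_tilt_cov_mx t : 0 < t -> posdefmx (tilt_cov_mx t).
Proof.
move=> t0; split=> [|u]; first by apply/matrixP => i j; rewrite !mxE tilt_covC.
apply: contra_neqT; rewrite -leNgt => uAu.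
pose y (x : 'rV[R]_n) := (x *m u^T) 0 0.
have yE : y = fun x => ((x - 0) *m u^T) 0 0.
  by apply/funext => x; rewrite subr0.
have ty : tame y by rewrite yE; exact: tame_affine.
pose c := tiltexp mu t y.
have tyc : tame (fun x => (y x - c) ^+ 2).
  have : tame (fun x => y x - c) by apply: tameB => //; exact: tame_cst.
  by move=> h; exact: (tameM h h).
have int0 : gaussint mu t (fun x => (y x - c) ^+ 2) = 0.
  have : tilt_cov t y y <= 0 by rewrite yE tilt_cov_affine// trmxK.
  rewrite tilt_covE// -/c pmulr_lle0 ?invr_gt0 ?gaussint1_gt0 ?(ltW t0)// => le0.
  apply/eqP; rewrite eq_le le0/=; apply: Rintegral_ge0 => x _.
  by rewrite mulr_ge0 ?sqr_ge0// ltW// gauss_weight_gt0.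
have ae0 : ae_eq mu setT (fun x => ((y x - c) ^+ 2 * gauss_weight t x)%:E) (cst 0%E).
  have ityc := tame_integrable mu t0 tyc.
  apply/ae_eq_integral_abs => //; first exact: (measurable_int mu).
  rewrite -[RHS]/(0%:E) -int0 fineK; last exact: integrable_fin_num.
  apply: eq_integral => x _; rewrite gee0_abs// lee_fin.
  by rewrite mulr_ge0 ?sqr_ge0// ltW// gauss_weight_gt0.
have Ry i : \int[mu]_x (x 0 i * (y x - c)) = 0.
  rewrite /Rintegral (_ : integral _ _ _ = 0%E)//.
  rewrite -(integral0 mu setT); apply: ae_eq_integral => //.
    apply/measurable_EFinP/measurable_funM; first exact: measurable_coord.
    by apply: measurable_funB => //; exact: tame_measurable.
  apply: filterS ae0 => x H _; have := H Logic.I => -[] /eqP.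
  rewrite mulf_eq0 (gt_eqF (gauss_weight_gt0 _ _)) orbF sqrf_eq0 => /eqP ->.
  by rewrite mulr0.
(* The integral in [Ry] is the [i]-th coordinate of [u]: by isotropy, the [x_j]
   are orthonormal and centred under [mu]. *)
apply/rowP => i; rewrite mxE -[RHS](Ry i).
pose F (s : seq 'I_n) (x : 'rV[R]_n) := \sum_(j <- s) u 0 j * (x 0 i * x 0 j).
have FE s : mu.-integrable setT (EFin \o F s) /\
    \int[mu]_x F s x = \sum_(j <- s) u 0 j * (i == j)%:R.
  elim: s => [|j s [IH1 IH2]]; rewrite /F.
    under eq_fun do rewrite big_nil.
    split; first exact: (finite_measure_integrable_cst mu 0).
    by rewrite big_nil Rintegral_cst// mul0r.
  have [ij ijE] := isotropic_integralM i j.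
  have iuj : mu.-integrable setT (EFin \o (fun x : 'rV[R]_n => u 0 j * (x 0 i * x 0 j))).
    exact: (integrableZl measurableT (u 0 j) ij).
  under eq_fun do rewrite big_cons.
  split; first exact: (integrableD measurableT iuj IH1).
  by rewrite big_cons RintegralD// IH2 RintegralZl// ijE.
have [iF FI] := FE (index_enum 'I_n).
have [ii iE] := isotropic_integral i.
rewrite (_ : (fun x => _) = fun x => F (index_enum 'I_n) x - c * x 0 i); last first.
  apply/funext => x; rewrite mulrBr [x 0 i * c]mulrC; congr (_ - _).
  rewrite /F /y mxE mulr_sumr; apply: eq_bigr => j _.
  by rewrite [u^T _ _]mxE; ring.
rewrite RintegralB//; last exact: (integrableZl measurableT c ii).
rewrite RintegralZl// iE mulr0 subr0 FI (bigD1 i)//= eqxx mulr1 big1 ?addr0// => j.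
by rewrite eq_sym => /negPf ->; rewrite mulr0.
Qed.

End tilted_covariance.

(** * Isotropic normalisation of the tilted measures *)

Lemma expectation_distribution d d' (T : measurableType d)
    (T' : measurableType d') (R : realType) (P : probability T R)
    (phi : {mfun T >-> T'}) (g : T' -> R) : measurable_fun setT g ->
  ('E_(distribution P phi)[g] = 'E_P[g \o phi])%E.
Proof.
move=> mg; rewrite unlock /distribution integral_pushforward_signed//.
exact/measurable_EFinP.
Qed.

Lemma covariance_distribution d d' (T : measurableType d)
    (T' : measurableType d') (R : realType) (P : probability T R)
    (phi : {mfun T >-> T'}) (f g : T' -> R) :
  measurable_fun setT f -> measurable_fun setT g ->
  covariance (distribution P phi) f g = covariance P (f \o phi) (g \o phi).
Proof.
move=> mf mg; rewrite unlock !expectation_distribution//.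
by apply: measurable_funM; exact: measurable_funB.
Qed.

(** The affine map [L^-1 (x - m)], in row-vector notation. If [m] is the mean and
    [L *m L^T] the covariance matrix of a random vector [X], then
    [whiten L m X] is isotropic. *)
Definition whiten (R : realType) n (L : 'M[R]_n) (m x : 'rV[R]_n) : 'rV[R]_n :=
  (x - m) *m (invmx L)^T.

Lemma tame_whiten (R : realType) n (L : 'M[R]_n) m :
  tame (fun x => eucl_norm (whiten L m x) ^+ 2).
Proof.
rewrite (_ : (fun x => _) =
  fun x => \sum_i whiten L m x 0 i * whiten L m x 0 i); last first.
  by apply/funext => x; rewrite eucl_norm_sqr; apply: eq_bigr => i _; rewrite expr2.
by apply: tame_sum => i; apply: tameM; exact: tame_affine.
Qed.

(** The normalisation of [mu_s] is isotropic and log-concave, so that a bound on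
    the variance of [|y|^2] valid for all such measures applies to it. *)
Lemma whitened_tilt (R : realType) n (mu : probability 'rV[R]_n R) (s : R)
    (L : 'M[R]_n) :
  log_concave_measure mu -> 0 < s -> is_trig_mx L -> (forall i, 0 < L i i) ->
  tilt_cov_mx mu s = L *m L^T ->
  exists nu : probability 'rV[R]_n R,
    [/\ isotropic nu, log_concave_measure nu &
      'V_nu[fun y : 'rV[R]_n => (eucl_norm y ^+ 2)%R] =
      (tilt_cov mu s (fun x => eucl_norm (whiten L (tilt_mean mu s) x) ^+ 2)
                    (fun x => eucl_norm (whiten L (tilt_mean mu s) x) ^+ 2))%:E]%E.
Proof.
move=> [f fd lf] s0 trigL posL covE; set m := tilt_mean mu s.
have mphi : measurable_fun setT (whiten L m).
  rewrite (_ : whiten L m = fun x => x *m (invmx L)^T + - m *m (invmx L)^T).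
    exact: measurable_affine.
  by apply/funext => x; rewrite /whiten mulmxDl.
have [phi phiE] : exists phi : {mfun 'rV[R]_n >-> 'rV[R]_n}, phi = whiten L m :> (_ -> _).
  pose mix := isMeasurableFun.Build _ _ _ _ _ mphi.
  pose phi : {mfun 'rV[R]_n >-> 'rV[R]_n} := HB.pack (whiten L m) mix.
  by exists phi.
have tphi i : tame (fun x => phi x 0 i) by rewrite phiE; exact: tame_affine.
pose nu : probability 'rV[R]_n R := distribution (gauss_tilt mu s) phi.
exists nu; split.
- split.
    apply/rowP => i; rewrite !mxE expectation_distribution; last exact: measurable_coord.
    rewrite expectation_gauss_tilt//; last exact: tphi.
    by rewrite phiE; exact: tiltexp_affine.
  apply/matrixP => i j; rewrite mxE.
  rewrite covariance_distribution; [|exact: measurable_coord|exact: measurable_coord].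
  rewrite covariance_gauss_tilt//; [|exact: tphi|exact: tphi].
  rewrite -/(tilt_cov mu s _ _) phiE /= tilt_cov_affine// covE trmxK !mulmxA.
  by rewrite mulVmx ?trig_gt0_unitmx// mul1mx -trmx_mul mulVmx ?trig_gt0_unitmx// trmx1.
- have fs := gauss_tilt_has_density (ltW s0) fd.
  have [_ f0 _] := fd.
  have Z0 : 0 < (fine (tiltZ mu s))^-1 by rewrite invr_gt0 -gaussint1E gaussint1_gt0// ltW.
  have detL : 0 < \det L by rewrite det_trig// prodr_gt0.
  exists (fun y => \det L * ((fine (tiltZ mu s))^-1 *
    (f (y *m L^T + m) * gauss_weight s (y *m L^T + m)))).
    have phiE' x : phi x = (x - m) *m (invmx L)^T by rewrite phiE.
    exact: (distribution_affine_has_density trigL posL phiE' fs).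
  have w0 x : 0 <= @gauss_weight R n s x by rewrite ltW// gauss_weight_gt0.
  apply: log_concaveM => [|x||]; [by move=> _; exact: ltW| |exact: log_concave_cst|].
    exact: mulr_ge0 (ltW Z0) (mulr_ge0 (f0 _) (w0 _)).
  apply: (@log_concave_affine _ _ _ _ _
    (fun x => (fine (tiltZ mu s))^-1 * (f x * gauss_weight s x))).
  apply: log_concaveM => [|x||]; [by move=> _; exact: ltW| |exact: log_concave_cst|].
    exact: mulr_ge0 (f0 _) (w0 _).
  by apply: log_concaveM => //; exact: log_concave_gauss_weight (ltW s0).
- have mq := tame_measurable (@tame_eucl_norm R n).
  rewrite /variance covariance_distribution// covariance_gauss_tilt//;
    by rewrite ?phiE//=; exact: tame_whiten.
Qed.

(** Concavity of [ln \det], applied to the covariance under [mu_r] of the vector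
    that normalises [mu_s]. The trace of that covariance is bounded by the
    second moment, which spares differentiating the mean. *)
Lemma ln_det_tilt_cov_mx_le (R : realType) n (mu : probability 'rV[R]_n R) (r s : R)
    (L : 'M[R]_n) :
  isotropic mu -> 0 < r -> is_trig_mx L -> (forall i, 0 < L i i) ->
  tilt_cov_mx mu s = L *m L^T ->
  ln (\det (tilt_cov_mx mu r)) - ln (\det (tilt_cov_mx mu s)) <=
  tiltexp mu r (fun x => eucl_norm (whiten L (tilt_mean mu s) x) ^+ 2) - n%:R.
Proof.
move=> iso r0 trigL posL covE; set m := tilt_mean mu s.
have uL := trig_gt0_unitmx trigL posL.
have detL : 0 < \det L by rewrite det_trig// prodr_gt0.
have pr := posdefmx_tilt_cov_mx iso r0.
pose M := (invmx L)^T; pose X := M^T *m tilt_cov_mx mu r *m M.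
have pX : posdefmx X by apply: posdefmx_congr => //; rewrite unitmx_tr unitmx_inv.
have detX : ln (\det X) = ln (\det (tilt_cov_mx mu r)) - ln (\det (tilt_cov_mx mu s)).
  rewrite !det_mulmx trmxK covE !det_mulmx !det_tr det_inv.
  have dr := posdefmx_det_gt0 pr.
  rewrite (_ : _^-1 * _ / _ = \det (tilt_cov_mx mu r) / (\det L * \det L)); last first.
    by field; rewrite gt_eqF.
  by rewrite ln_div ?posrE ?mulr_gt0.
rewrite -detX; apply: le_trans (ln_det_le_mxtrace pX) _; rewrite lerD2r.
rewrite (_ : (fun x => _) =
  fun x => \sum_i whiten L m x 0 i * whiten L m x 0 i); last first.
  by apply/funext => x; rewrite eucl_norm_sqr; apply: eq_bigr => i _; rewrite expr2.
have tw i : tame (fun x => whiten L m x 0 i) by exact: tame_affine.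
rewrite tiltexp_sum// => [|i]; last exact: tameM.
apply: ler_sum => i _; rewrite /X -(tilt_cov_affine mu M m)// /tilt_cov.
by rewrite lerBlDr lerDl -expr2 sqr_ge0.
Qed.

Lemma tiltexp_whiten (R : realType) n (mu : probability 'rV[R]_n R) (s : R)
    (L : 'M[R]_n) : 0 < s -> L \in unitmx -> tilt_cov_mx mu s = L *m L^T ->
  tiltexp mu s (fun x => eucl_norm (whiten L (tilt_mean mu s) x) ^+ 2) = n%:R.
Proof.
move=> s0 uL covE; set m := tilt_mean mu s.
rewrite (_ : (fun x => _) =
  fun x => \sum_i whiten L m x 0 i * whiten L m x 0 i); last first.
  by apply/funext => x; rewrite eucl_norm_sqr; apply: eq_bigr => i _; rewrite expr2.
have tw i : tame (fun x => whiten L m x 0 i) by exact: tame_affine.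
rewrite tiltexp_sum// => [|i]; last exact: tameM.
rewrite -[n in RHS]card_ord -sumr_const; apply: eq_bigr => i _.
have := tilt_cov_affine mu (invmx L)^T m i i s0; rewrite /tilt_cov.
rewrite tiltexp_affine// mul0r subr0 => ->.
by rewrite covE trmxK !mulmxA mulVmx// mul1mx -trmx_mul mulVmx// trmx1 mxE eqxx.
Qed.

(** * The decreasing quantity *)

Section lyapunov.
Context {R : realType} {n : nat} (mu : probability 'rV[R]_n R) (D : R).

(** The function [f t = 1/n * ln (det A_t)]. *)
Definition mean_log_det t : R := n%:R^-1 * ln (\det (tilt_cov_mx mu t)).

(** The function [b t = 1/n * tr B_t]. *)
Definition mean_energy t : R :=
  n%:R^-1 * \sum_i tiltexp mu t (fun x => x 0 i * x 0 i).

(** The combination of [f] and [b] that decreases in time. *)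
Definition lyapunov t : R := - 2 * mean_log_det t + mean_energy t - D * t.

Hypothesis iso : isotropic mu.

Lemma det_tilt_cov_mx_gt0 t : 0 <= t -> 0 < \det (tilt_cov_mx mu t).
Proof.
rewrite le_eqVlt => /predU1P[<-|t0]; first by rewrite tilt_cov_mx0// det1.
exact/posdefmx_det_gt0/posdefmx_tilt_cov_mx.
Qed.

Lemma continuous_lyapunov : continuous (fun t : R => lyapunov `|t|).
Proof.
have cdet : continuous (fun t : R => \det (tilt_cov_mx mu `|t|)).
  by apply: (@continuous_det _ _ (fun t : R => tilt_cov_mx mu `|t|)) => i j; exact: continuous_tilt_cov_mx.
have clogdet : continuous (fun t : R => mean_log_det `|t|).
  move=> t; apply: cvgM; first exact: cvg_cst.
  apply: continuous_cvg; first by apply: continuous_ln; rewrite det_tilt_cov_mx_gt0.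
  exact: cdet.
have cenergy : continuous (fun t : R => mean_energy `|t|).
  move=> t; apply: cvgM; first exact: cvg_cst.
  apply: continuous_bigsum => i u; apply: continuous_tiltexp.
  by have [] := isotropic_integralM iso i i.
move=> t; apply: cvgB.
  apply: cvgD; last exact: cenergy.
  by apply: cvgM; [exact: cvg_cst|exact: clogdet].
by apply: cvgM; [exact: cvg_cst|exact: norm_continuous].
Qed.

Lemma lyapunov0 : (0 < n)%N -> lyapunov 0 = 1.
Proof.
move=> n0; rewrite /lyapunov /mean_log_det /mean_energy tilt_cov_mx0// det1 ln1.
rewrite !mulr0 subr0 add0r.
under eq_bigr => i _.
  rewrite tiltexp0; have [_ ->] := isotropic_integralM iso i i; rewrite eqxx; over.
by rewrite sumr_const card_ord mulVf// pnatr_eq0 -lt0n.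
Qed.

End lyapunov.

Lemma le_lyapunov0 (R : realType) n (mu : probability 'rV[R]_n R)
    (D t : R) : (0 < n)%N ->
  (forall nu : probability 'rV[R]_n R, isotropic nu -> log_concave_measure nu ->
    ((n%:R^-1)%:E * 'V_nu[fun x : 'rV[R]_n => (eucl_norm x ^+ 2)%R]
       <= (2 * D)%:E)%E) ->
  isotropic mu -> log_concave_measure mu -> 0 < t ->
  lyapunov mu D t <= lyapunov mu D 0.
Proof.
move=> n0 A iso lc t0.
have nR : 0 < n%:R :> R by rewrite ltr0n.
apply: nonincreasing_touch => //.
  have E : {in `[0, t]%classic, (fun x => lyapunov mu D `|x|) =1 lyapunov mu D}.
    by move=> x; rewrite inE/= in_itv/= => /andP[x0 _]; rewrite ger0_norm.
  apply: (subspace_eq_continuous E); apply: continuous_subspaceT.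
  exact: continuous_lyapunov.
move=> s /andP[s0 st].
have [L [trigL posL covE]] := cholesky (posdefmx_tilt_cov_mx iso s0).
have uL := trig_gt0_unitmx trigL posL.
set U := fun x => eucl_norm (whiten L (tilt_mean mu s) x) ^+ 2.
pose q (x : 'rV[R]_n) := eucl_norm x ^+ 2.
have tU : tame U by exact: tame_whiten.
have tq : tame q by exact: tame_eucl_norm.
have [nu [nuiso nulc nuV]] := whitened_tilt lc s0 trigL posL covE.
have varU : tilt_cov mu s U U <= 2 * D * n%:R.
  by have := A nu nuiso nulc; rewrite nuV -EFinM lee_fin mulrC ler_pdivrMr.
(* The lower bound of [lyapunov] near [s] given by [ln_det_tilt_cov_mx_le]. *)
exists (fun r => n%:R^-1 * (tiltexp mu r q - 2 * tiltexp mu r U) - D * r).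
exists (n%:R^-1 * (- (tilt_cov mu s q q / 2) - 2 * - (tilt_cov mu s U q / 2)) - D).
split.
- have dq := is_derive_tiltexp mu s0 tq.
  have dU := is_derive_tiltexp mu s0 tU.
  apply: is_derive_eq.
  by rewrite /GRing.scale/= /tilt_cov; ring.
(* [Var_s (q - U) >= 0] bounds the covariance of [U] and [q]. *)
- have tNU : tame (fun x => -1 * U x) by apply: tameM => //; exact: tame_cst.
  have tqU : tame (fun x => q x + -1 * U x) by exact: tameD.
  have E g : tame g -> tilt_cov mu s (fun x => q x + -1 * U x) g =
      tilt_cov mu s q g - tilt_cov mu s U g.
    by move=> tg; rewrite tilt_covDl// tilt_covZl// mulN1r.
  have := tilt_cov_ge0 mu s0 tqU.
  rewrite (E _ tqU) (tilt_covC _ s q) (tilt_covC _ s U) (E _ tq) (E _ tU).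
  rewrite [tilt_cov mu s q U]tilt_covC => H.
  rewrite subr_le0 ler_pdivrMl//; lra.
- move=> r /andP[r0 rs].
  have detle := ln_det_tilt_cov_mx_le iso r0 trigL posL covE.
  rewrite -[X in _ <= _ - X](tiltexp_whiten s0 uL covE) -/U in detle.
  rewrite /lyapunov /mean_log_det /mean_energy -!tiltexp_eucl_norm// -/q.
  have nI : 0 <= n%:R^-1 :> R by rewrite invr_ge0 ltW.
  have key (N a c qr qs ur us : R) : 0 <= N -> a - c <= ur - us ->
      N * (qr - 2 * ur) - D * r - (N * (qs - 2 * us) - D * s) <=
      - 2 * (N * a) + N * qr - D * r - (- 2 * (N * c) + N * qs - D * s).
    move=> N0 ac; rewrite -subr_ge0.
    rewrite (_ : _ - _ = 2 * (N * ((ur - us) - (a - c)))); last by ring.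
    by rewrite mulr_ge0// mulr_ge0// subr_ge0.
  exact: key nI detle.
Qed.

(** (A) implies (B), for a given measure [mu] in the conclusion. *)
Lemma log_det_ge (R : realType) n (mu : probability 'rV[R]_n R)
    (D t : R) : (0 < n)%N ->
  (forall nu : probability 'rV[R]_n R, isotropic nu -> log_concave_measure nu ->
    ((n%:R^-1)%:E * 'V_nu[fun x : 'rV[R]_n => (eucl_norm x ^+ 2)%R]
       <= (2 * D)%:E)%E) ->
  isotropic mu -> log_concave_measure mu -> 0 < t ->
  - (D * t) <= mean_log_det mu t.
Proof.
move=> n0 A iso lc t0.
have := le_lyapunov0 n0 A iso lc t0; rewrite lyapunov0// /lyapunov.
have : 1 + mean_log_det mu t <= mean_energy mu t.
  apply: le_trans (expR_ge1Dx _) _.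
  apply: le_trans (expR_ln_det_le_mxtrace n0 (posdefmx_tilt_cov_mx iso t0)) _.
  rewrite /mean_energy -tiltexp_eucl_norm// ler_wpM2l ?invr_ge0 ?ler0n//.
  exact: mxtrace_tilt_cov_mx_le.
lra.
Qed.

(** * From second moments to the variance, and the equivalences *)

(** The derivative of [exp (- _)] between [u] and [v] is at least
    [exp (- u) * exp (- v)] in absolute value. *)
Lemma sqr_mulr_expRN_le (R : realType) (u v : R) : 0 <= u -> 0 <= v ->
  (v - u) ^+ 2 * (expR (- u) * expR (- v)) <= (v - u) * (expR (- u) - expR (- v)).
Proof.
wlog uv : u v / u <= v => [H u0 v0|u0 v0].
  have [uv|/ltW vu] := leP u v; first exact: H.
  by have := H _ _ vu v0 u0; rewrite [expR (- v) * _]mulrC -[u - v]opprB sqrrN mulNr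
    -mulrN opprB.
rewrite expr2 -mulrA ler_wpM2l ?subr_ge0//.
have -> : expR (- u) - expR (- v) = expR (- v) * (expR (v - u) - 1).
  by rewrite mulrBr -expRD mulr1; congr (expR _ - _); ring.
rewrite mulrA [leRHS]mulrC ler_wpM2r ?expR_ge0//.
rewrite lerBrDl (le_trans _ (expR_ge1Dx _))// lerD2l ler_piMr ?subr_ge0//.
by rewrite -expR0 ler_expR lerNl oppr0.
Qed.

(** (C) implies (A), for a single isotropic measure; log-concavity plays no role
    in this implication. *)
Lemma variance_le_of_energy (R : realType) n (mu : probability 'rV[R]_n R)
    (D : R) : (0 < n)%N -> 0 <= D -> isotropic mu ->
  (forall t, 0 < t -> expR (- (D * t)) <=
     n%:R^-1 * tiltexp mu t (fun x => eucl_norm x ^+ 2)) ->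
  ((n%:R^-1)%:E * 'V_mu[fun x : 'rV[R]_n => (eucl_norm x ^+ 2)%R]
       <= (2 * D)%:E)%E.
Proof.
move=> n0 D0 iso H; have nR : 0 < n%:R :> R by rewrite ltr0n.
pose q (x : 'rV[R]_n) := eucl_norm x ^+ 2.
have tq : tame q by exact: tame_eucl_norm.
pose F x := (n%:R - q x) ^+ 2.
have tnq : tame (fun x => n%:R - q x) by apply: tameB => //; exact: tame_cst.
have tF : tame F by exact: (tameM tnq tnq).
have F0 x : 0 <= F x by exact: sqr_ge0.
have [iq Eq] : mu.-integrable setT (EFin \o q) /\ \int[mu]_x q x = n%:R.
  pose G (r : seq 'I_n) (x : 'rV[R]_n) := \sum_(i <- r) x 0 i * x 0 i.
  have GE r : mu.-integrable setT (EFin \o G r) /\ \int[mu]_x G r x = (size r)%:R.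
    elim: r => [|i r [IH1 IH2]]; rewrite /G.
      under eq_fun do rewrite big_nil.
      by split; [exact: (finite_measure_integrable_cst mu 0)|rewrite Rintegral_cst// mul0r].
    have [ii iE] := isotropic_integralM iso i i.
    under eq_fun do rewrite big_cons.
    split; first exact: (integrableD measurableT ii IH1).
    by rewrite RintegralD// IH2 iE eqxx/= -[RHS]natr1 addrC.
  rewrite (_ : q = G (index_enum 'I_n)); last first.
    by apply/funext => x; rewrite /q eucl_norm_sqr; apply: eq_bigr => i _; rewrite expr2.
  have [-> ->] := GE (index_enum 'I_n); split=> //.
  by rewrite -[size _]/(size (index_enum 'I_n)) -[in RHS](card_ord n) cardT enumT.
have inq : mu.-integrable setT (EFin \o (fun x => n%:R - q x)).
  exact: (integrableB measurableT (finite_measure_integrable_cst mu n%:R measurableT) iq).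
have Enq : \int[mu]_x (n%:R - q x) = 0.
  rewrite RintegralB//; last exact: (finite_measure_integrable_cst mu n%:R).
  rewrite Eq Rintegral_cst// (_ : fine (mu setT) = 1) ?mulr1 ?subrr//.
  by rewrite probability_setT.
have bound t : 0 < t -> gaussint mu t F <= 2 * D * n%:R * expR (t / 2 * n%:R).
  (* [c] is the value of the weight on the sphere [q = n]. *)
  move=> t0; pose c := expR (- (t / 2 * n%:R)).
  have c0 : 0 < c by exact: expR_gt0.
  have t20 : 0 < t / 2 by rewrite divr_gt0.
  have Z0 := gaussint1_gt0 mu (ltW t0).
  have inqw := tame_integrable mu t0 tnq.
  have iFw := tame_integrable mu t0 tF.
  have le1 : gaussint mu t (fun x => n%:R - q x) <= n%:R * D * t.
    have := H t t0; rewrite -/q /tiltexp mulrA ler_pdivlMr// ler_pdivlMl// => Ht.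
    have -> : gaussint mu t (fun x => n%:R - q x) =
        n%:R * gaussint mu t (fun=> 1) - gaussint mu t q.
      rewrite (_ : (fun x => _) = fun x => n%:R * 1 + -1 * q x); last first.
        by apply/funext => x; rewrite mulr1 mulN1r.
      have tc := @tame_cst R n.
      by rewrite gaussintD// ?gaussintZ// ?mulN1r//; exact: tameM.
    rewrite lerBlDr; apply: le_trans (_ : n%:R * D * t * gaussint mu t (fun=> 1) +
      n%:R * (expR (- (D * t)) * gaussint mu t (fun=> 1)) <= _); last first.
      apply: lerD => //; apply: ler_piMr; last exact: gaussint1_le1 (ltW t0).
      by rewrite mulr_ge0 ?(ltW t0)// mulr_ge0// ltW.
    have := expR_ge1Dx (- (D * t)); rewrite -subr_ge0 => He.
    rewrite -subr_ge0 (_ : _ - _ =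
      n%:R * ((expR (- (D * t)) - (1 + - (D * t))) * gaussint mu t (fun=> 1)));
      last by ring.
    by rewrite mulr_ge0 ?(ltW nR)// mulr_ge0// ltW.
  have le2 : t / 2 * c * gaussint mu t F <= gaussint mu t (fun x => n%:R - q x).
    rewrite -[leRHS]subr0 -(mulr0 c) -Enq -!RintegralZl// -RintegralB//; last first.
      exact: (integrableZl measurableT c inq).
    apply: le_Rintegral => //.
    - exact: (integrableZl measurableT _ iFw).
    - exact: (integrableB measurableT inqw (integrableZl measurableT c inq)).
    move=> x _; rewrite [c * _]mulrC -mulrBr.
    have u0 : 0 <= t / 2 * q x by rewrite mulr_ge0 ?(ltW t20)// sqr_ge0.
    have v0 : 0 <= t / 2 * n%:R by rewrite mulr_ge0 ?(ltW t20)// ltW.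
    have := sqr_mulr_expRN_le u0 v0; rewrite -/c.
    have <- : gauss_weight t x = expR (- (t / 2 * q x)).
      by rewrite /gauss_weight mulNr.
    move=> le; rewrite -(ler_pM2l t20); apply: le_trans (le_trans _ le) _;
      rewrite le_eqVlt /F; apply/orP; left; apply/eqP; ring.
  have := le_trans le2 le1.
  rewrite -ler_pdivlMl ?mulr_gt0// => /le_trans; apply.
  rewrite /c expRN le_eqVlt; apply/orP; left; apply/eqP; field.
  by rewrite !gt_eqF ?expR_gt0.
(* Along [tk], decreasing to 0, the weighted integrands increase to [F]. *)
pose tk (k : nat) : R := k.+1%:R^-1.
have tk0 k : 0 < tk k by rewrite invr_gt0 ltr0n.
have tk_cvg : tk @ \oo --> (0 : R) by exact: cvg_harmonic.
have intF : (\int[mu]_x (F x)%:E <= (2 * D * n%:R)%:E)%E.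
  pose g k x := (F x * gauss_weight (tk k) x)%:E.
  have cg x : g k x @[k --> \oo] --> (F x)%:E.
    apply: cvg_EFin; first exact: nearW.
    rewrite -[F x in X in _ --> X]mulr1 -(gauss_weight0 x).
    apply: cvgM; first exact: cvg_cst.
    apply: continuous_cvg; first exact: continuous_expR.
    apply: cvgM; last exact: cvg_cst.
    by apply: cvgN; apply: cvgM; [exact: tk_cvg|exact: cvg_cst].
  have mg k : measurable_fun setT (g k).
    apply/measurable_EFinP/measurable_funM; first exact: tame_measurable.
    exact: measurable_gauss_weight.
  have g0 k x : setT x -> (0 <= g k x)%E.
    by move=> _; rewrite lee_fin mulr_ge0// ltW// gauss_weight_gt0.
  have ndg x : setT x -> {homo g ^~ x : k l / (k <= l)%N >-> (k <= l)%E}.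
    move=> _ k l kl; rewrite lee_fin ler_wpM2l// gauss_weight_le//.
    by rewrite lef_pV2 ?posrE ?ltr0n// ler_nat.
  have -> : (\int[mu]_x (F x)%:E = \int[mu]_x limn (g ^~ x))%E.
    by apply: eq_integral => x _; apply/esym/cvg_lim => //; exact: cg.
  have cv : (2 * D * n%:R * expR (tk k / 2 * n%:R))%:E @[k --> \oo] --> (2 * D * n%:R)%:E.
    apply: cvg_EFin; first exact: nearW.
    have lE : 2 * D * n%:R = 2 * D * n%:R * expR (0 / 2 * n%:R).
      by rewrite !mul0r expR0 mulr1.
    rewrite [X in _ --> X]lE.
    apply: cvgM; first exact: cvg_cst.
    apply: continuous_cvg; first exact: continuous_expR.
    apply: cvgM; last exact: cvg_cst.
    by apply: cvgM; [exact: tk_cvg|exact: cvg_cst].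
  have cI := @cvg_monotone_convergence _ _ _ mu _ measurableT _ mg g0 ndg.
  rewrite -(cvg_lim _ cI)// -(cvg_lim _ cv)//; apply: lee_lim.
  - by apply/cvg_ex; eexists; exact: cI.
  - by apply/cvg_ex; eexists; exact: cv.
  apply: nearW => k; apply: le_trans (_ : (gaussint mu (tk k) F)%:E <= _)%E; last first.
    by rewrite lee_fin bound.
  by rewrite fineK//; exact: integrable_fin_num (tame_integrable mu (tk0 k) tF).
have VE : ('V_mu[fun x : 'rV[R]_n => (eucl_norm x ^+ 2)%R] = \int[mu]_x (F x)%:E)%E.
  rewrite /variance unlock.
  have -> : (fine ('E_mu[fun x : 'rV[R]_n => (eucl_norm x ^+ 2)%R]) = n%:R)%E.
    by rewrite unlock -[RHS]Eq.
  rewrite unlock; apply: eq_integral => x _; congr EFin.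
  by transitivity ((q x - n%:R) * (q x - n%:R)); [|rewrite /F; ring].
rewrite VE; apply: le_trans (lee_wpmul2l _ intF) _.
  by rewrite lee_fin invr_ge0 ltW.
by rewrite -EFinM lee_fin mulrC mulfK// gt_eqF.
Qed.

Theorem corollary3p2 (R : realType) (n : nat) (D : R)
    (hn : (1 <= n)%N) (hD : 0 < D) :
  let A := forall mu : probability 'rV[R]_n R,
    isotropic mu -> log_concave_measure mu ->
    ((n%:R^-1)%:E * 'V_mu[fun x : 'rV[R]_n => (eucl_norm x ^+ 2)%R]
       <= (2 * D)%:E)%E in
  let B := forall mu : probability 'rV[R]_n R,
    isotropic mu -> log_concave_measure mu ->
    forall t : R, 0 < t ->
      - (D * t) <= n%:R^-1 * ln (\det (cov_mx (gauss_tilt mu t))) in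
  let C := forall mu : probability 'rV[R]_n R,
    isotropic mu -> log_concave_measure mu ->
    forall t : R, 0 < t ->
      expR (- (D * t)) <=
        n%:R^-1 * \tr (second_moment_mx (gauss_tilt mu t)) in
  (A <-> B) /\ (B <-> C).
Proof.
move=> A B C.
have AB : A -> B.
  by move=> a mu iso lc t t0; rewrite cov_mx_gauss_tilt//; exact: log_det_ge.
have BC : B -> C.
  move=> hB mu iso lc t t0; rewrite mxtrace_second_moment_mx//.
  apply: (@le_trans _ _ (n%:R^-1 * \tr (tilt_cov_mx mu t))); last first.
    by rewrite ler_wpM2l ?invr_ge0 ?ler0n// mxtrace_tilt_cov_mx_le.
  apply: le_trans (expR_ln_det_le_mxtrace hn (posdefmx_tilt_cov_mx iso t0)).
  by rewrite ler_expR -cov_mx_gauss_tilt//; exact: hB.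
have CA : C -> A.
  move=> hC mu iso lc; apply: variance_le_of_energy => //; [exact: ltW|move=> t t0].
  by rewrite -mxtrace_second_moment_mx//; exact: hC.
by split; split=> // H; [exact: CA (BC H)|exact: AB (CA H)].
Qed.
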